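(* Let $\mathcal F=\{f_1,\dots,f_N\}$ be a strictly contracting iterated function system on $\mathbb R^D$ (that is, there is $0<a<1$ with $\|f_i(x)-f_i(y)\|\le a\|x-y\|$ for all $x,y$ and all $i$), with attractor $\Lambda$ satisfying $\dim_{\mathrm L}\Lambda>0$. Let $\mu$ be a $\sigma$-invariant Borel probability measure on $\Sigma=\{1,\dots,N\}^{\mathbb N}$ with one-sided exponential decay of correlations, and let $\overleftarrow{\nu}=\pi_*\overleftarrow{\mu}$ be the push-forward of the reversed measure, fully supported on $\Lambda$. Then for $\mu$-a.e. $\mathbf i\in\Sigma$ and every $x_0\in\Lambda$ $$\liminf_{r\to0}\frac{\log T_r(\mathbf i,x_0)}{-\log r}=\underline{\dim}_{\mathrm M}(\overleftarrow{\nu})\quad\text{and}\quad \limsup_{r\to0}\frac{\log T_r(\mathbf i,x_0)}{-\log r}=\overline{\dim}_{\mathrm M}(\overleftarrow{\nu}).$$ In particular, if $\mu=\mu_{\mathbf p}=\mathbf p^{\mathbb N}$ is the Bernoulli measure of a probability vector $\mathbf p=(p_1,\dots,p_N)$ with all $p_i>0$, then the same holds with $\overleftarrow{\nu}$ replaced by $\nu_{\mathbf p}=\pi_*\mu_{\mathbf p}$.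
   Context: The attractor $\Lambda\subset\mathbb R^D$ is the unique non-empty compact set with $\Lambda=\bigcup_{i=1}^N f_i(\Lambda)$. No separation condition is assumed. Symbolic notation: $\Sigma=\{1,\dots,N\}^{\mathbb N}$; $\sigma$ is the left shift; $\Sigma^*$ is the set of finite words over $\{1,\dots,N\}$; for $\bar\imath\in\Sigma^*$, $|\bar\imath|$ is its length and $[\bar\imath]\subset\Sigma$ is the cylinder of sequences beginning with $\bar\imath$; $\overleftarrow{\bar\imath}$ is the word $\bar\imath$ read in reverse order. The natural projection is $\pi:\Sigma\to\Lambda$, $\pi(\mathbf i)=\lim_{n\to\infty}f_{i_1}\circ\cdots\circ f_{i_n}(0)$. One-sided exponential decay (of correlations): there exist $\varepsilon>0$, $\kappa>0$ such that for all finite words $\bar\imath,\bar\jmath\in\Sigma^*$ and all integers $n\ge|\bar\imath|$, $\mu([\bar\imath]\cap\sigma^{-n}[\bar\jmath])\le(1+\kappa2^{-\varepsilon(n-|\bar\imath|)})\,\mu([\bar\imath])\,\mu([\bar\jmath])$. Reversed measure: $\overleftarrow{\mu}$ is the $\sigma$-invariant measure on $\Sigma$ determined by $\overleftarrow{\mu}([\bar\imath])=\mu([\overleftarrow{\bar\imath}])$ for all $\bar\imath\in\Sigma^*$. Orbit and cover time: for $x_0\in\Lambda$, $\mathcal O_n(\mathbf i,x_0)=\{x_0,f_{i_1}(x_0),f_{i_2}\circ f_{i_1}(x_0),\dots,f_{i_n}\circ\cdots\circ f_{i_1}(x_0)\}$, and $T_r(\mathbf i,x_0)=\inf\{n\ge0: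 d_{\mathrm H}(\mathcal O_n(\mathbf i,x_0),\Lambda)<r\}$, where $d_{\mathrm H}$ is the Hausdorff distance. Minkowski dimensions of a fully supported finite Borel measure $\nu$ on a compact metric space $X$ (here $X=\Lambda$; $B(x,r)$ open balls; $\inf\emptyset=\infty$): $\overline{\dim}_{\mathrm M}(\nu)$ is the infimum of $s\ge0$ for which there is $c>0$ with $\nu(B(x,r))\ge cr^s$ for all $x\in X$ and $0<r<1$; $\underline{\dim}_{\mathrm M}(\nu)$ is the infimum of $s\ge0$ for which there are $c>0$ and a sequence of positive reals $r_n\to0$ with $\nu(B(x,r_n))\ge cr_n^s$ for all $x\in X$ and $n\in\mathbb N$. Lower dimension: $\dim_{\mathrm L}X$ is the supremum of $\alpha$ for which there is $C>0$ such that for all $0<r<R\le|X|$ and $x\in X$, $N_r(B(x,R)\cap X)\ge C(R/r)^\alpha$, where $|X|$ is the diameter and $N_r(Y)$ is the smallest number of open sets of diameter $r$ needed to cover $Y$; a single point has lower dimension $0$ by convention. *)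

(* Defs.v *)
From HB Require Import structures.
From mathcomp Require Import all_boot all_order all_algebra.
From mathcomp Require Import all_classical all_reals all_analysis.
Set Implicit Arguments.
Unset Strict Implicit.
Unset Printing Implicit Defensive.
Import Order.TTheory GRing.Theory Num.Theory.
Import numFieldNormedType.Exports.
Local Open Scope classical_set_scope.
Local Open Scope ring_scope.

HB.instance Definition _ (N : nat) := isPointed.Build 'I_N.+1 ord0.

(* The norm of the library on 'rV[R]_D is the sup norm; every metric notion
   below uses the Euclidean norm. Both induce the topology of 'rV[R]_D. *)
Section euclidean.
Context {R : realType} {D : nat}.
Implicit Types (x y : 'rV[R]_D) (X Y A B : set 'rV[R]_D).

Definition enorm x : R := Num.sqrt (\sum_(k < D) x 0 k ^+ 2).

Definition edist x y : R := enorm (x - y).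

Definition eball x (r : R) : set 'rV[R]_D := [set y | edist x y < r].

Definition diam A : \bar R :=
  ereal_sup [set (edist p.1 p.2)%:E | p in A `*` A].

Definition dist_to x B : \bar R := ereal_inf [set (edist x y)%:E | y in B].

Definition hausdorff_dist A B : \bar R :=
  maxe (ereal_sup [set dist_to a B | a in A])
       (ereal_sup [set dist_to b A | b in B]).

(* The covering sets are open in R^D and have diameter exactly r; the value is
   +oo when there is no finite cover. *)
Definition covering_number (r : R) Y : \bar R :=
  ereal_inf [set (n%:R)%:E | n in [set n : nat |
    exists U : 'I_n -> set 'rV[R]_D,
      (forall k, open (U k) /\ diam (U k) = r%:E) /\
      Y `<=` \bigcup_k U k]].

Definition lower_dim X : \bar R :=
  if `[< exists x, X = [set x] >] then 0%E else
  ereal_sup [set alpha%:E | alpha in [set alpha : R |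
    exists2 C : R, 0 < C &
      forall (r R0 : R) x, 0 < r -> r < R0 -> (R0%:E <= diam X)%E -> X x ->
        ((C * (R0 / r) `^ alpha)%:E <=
         covering_number r (eball x R0 `&` X))%E]].

End euclidean.

(* R^D with its Borel sigma-algebra. *)
Definition borel_rV (R : realType) (D : nat) : measurableType _ :=
  g_sigma_algebraType (@open 'rV[R]_D).

(* The alphabet {1,..,N+1} is 'I_N.+1 and sequences are indexed from 0. The
   sigma-algebra is the Borel one of the product of discrete topologies. *)
Definition symb (N : nat) : measurableType _ :=
  g_sigma_algebraType
    (@open (prod_topology (fun _ : nat => discrete_topology 'I_N.+1))).

Section minkowski.
Context {R : realType} {D : nat}.
Implicit Types (nu : set (borel_rV R D) -> \bar R) (X : set 'rV[R]_D).

Definition measure_support nu : set 'rV[R]_D :=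
  [set x | forall U : set 'rV[R]_D, open U -> U x -> (0 < nu U)%E].

Definition fully_supported nu X := measure_support nu = X.

Definition upper_minkowski nu X : \bar R :=
  ereal_inf [set s%:E | s in [set s : R | 0 <= s /\
    exists2 c : R, 0 < c &
      forall (x : 'rV[R]_D) (r : R), X x -> 0 < r -> r < 1 ->
        ((c * r `^ s)%:E <= nu (eball x r `&` X))%E]].

Definition lower_minkowski nu X : \bar R :=
  ereal_inf [set s%:E | s in [set s : R | 0 <= s /\
    exists2 c : R, 0 < c &
      exists u : nat -> R, [/\ forall n, 0 < u n, u n @[n --> \oo] --> 0 &
        forall (x : 'rV[R]_D) (n : nat), X x ->
          ((c * u n `^ s)%:E <= nu (eball x (u n) `&` X))%E]]].

End minkowski.

Section symbolic.
Context {N : nat}.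
Implicit Types (i : symb N) (w v : seq 'I_N.+1).

Definition left_shift i : symb N := fun n => i n.+1.

Definition word_prefix i (n : nat) : seq 'I_N.+1 := mkseq i n.

Definition cylinder w : set (symb N) :=
  [set i | word_prefix i (size w) = w].

Context {R : realType}.
Implicit Types mu : probability (symb N) R.

Definition shift_invariant mu :=
  forall A : set (symb N), measurable A -> mu (left_shift @^-1` A) = mu A.

Definition one_sided_exp_decay mu :=
  exists eps kappa : R, [/\ 0 < eps, 0 < kappa &
    forall w v (n : nat), (size w <= n)%N ->
      (mu (cylinder w `&` iter n left_shift @^-1` cylinder v) <=
       (1 + kappa * 2 `^ (- eps * (n - size w)%:R))%:E *
         mu (cylinder w) * mu (cylinder v))%E].

Definition reversed_measure mu mur :=
  shift_invariant mur /\
  forall w, mur (cylinder w) = mu (cylinder (rev w)).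

Definition bernoulli_measure (p : 'I_N.+1 -> R) mu :=
  forall w, mu (cylinder w) = (\prod_(c <- w) p c)%:E.

End symbolic.

Section ifs.
Context {R : realType} {D N : nat}.
Variable f : 'I_N.+1 -> 'rV[R]_D -> 'rV[R]_D.
Implicit Types (i : symb N) (x : 'rV[R]_D) (X : set 'rV[R]_D).

Definition strictly_contracting :=
  exists2 a : R, 0 < a < 1 &
    forall c x y, edist (f c x) (f c y) <= a * edist x y.

Definition attractor X :=
  [/\ X !=set0, compact X & X = \bigcup_c (f c @` X)].

(* foldr composes as f_{i_1} o ... o f_{i_n}, foldl as f_{i_n} o ... o f_{i_1}. *)
Definition natural_proj i : borel_rV R D :=
  lim ((foldr f (0 : 'rV[R]_D) (word_prefix i n)) @[n --> \oo]).

Definition orbit_point i x (n : nat) : 'rV[R]_D :=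
  foldl (fun y c => f c y) x (word_prefix i n).

Definition ifs_orbit i x (n : nat) : set 'rV[R]_D :=
  [set orbit_point i x k | k in [set k | (k <= n)%N]].

(* The value is +oo when the orbit never comes r-close to X. *)
Definition cover_time X i x (r : R) : \bar R :=
  ereal_inf [set (n%:R)%:E | n in [set n : nat |
    (hausdorff_dist (ifs_orbit i x n) X < r%:E)%E]].

Definition cover_exponent X i x (r : R) : \bar R :=
  (lne (cover_time X i x r) / (- ln r)%:E)%E.

Definition cover_time_law X (mu : probability (symb N) R)
    (nu : set (borel_rV R D) -> \bar R) :=
  {ae mu, forall i, forall x, X x ->
    limf_einf (cover_exponent X i x) 0^'+ = lower_minkowski nu X /\
    limf_esup (cover_exponent X i x) 0^'+ = upper_minkowski nu X}.

End ifs.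

(* Main.v *)
Require Import Defs.
From HB Require Import structures.
From mathcomp Require Import all_boot all_order all_algebra.
From mathcomp Require Import all_classical all_reals all_analysis.
From mathcomp Require Import ring lra.
Set Implicit Arguments.
Unset Strict Implicit.
Unset Printing Implicit Defensive.
Import Order.TTheory GRing.Theory Num.Theory.
Import numFieldNormedType.Exports.
Local Open Scope classical_set_scope.
Local Open Scope ring_scope.

(** Write [nu] for the projection of the reversed measure and put
    [r = exp (- y)]. The point of the orbit at time [n] lies in
    [f_{i_n} o ... o f_{i_{n-m+1}} (Lam)], a set of diameter [<= a^m d], so up to
    an error [a^m d], visiting a ball at time [n] depends on a block of [m]
    letters only and has probability [nu (ball)]; [m] linear in [y] makes the
    error smaller than [r].

    Upper bounds on the cover time: cut time into blocks of length [m] separated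
    by gaps of length [m]. By the decay of correlations, a ball with
    [nu (ball) >= p := c r^s] is missed by [q + 1] blocks with probability at most
    [exp (- p q / 2)]. Sum over a net of [Lam] indexed by words of length [m] and
    apply Borel-Cantelli.

    Lower bounds: if [nu (B(x, r)) <= r^s], then [B(x, r)] is visited at a time
    between [m] and [r^{-t}], [t < s], with probability [O(r^{s-t})]. The orbit may
    visit it before time [m] only; as the lower dimension is positive, [m] balls
    of radius [r^{1 + delta}] do not cover the part of [Lam] in [B(x, r / 2)], so
    some point there stays uncovered. *)

(* The library has its own [edist], on extended metric spaces. *)
Local Notation edist := Defs.edist.

(** * Euclidean metric *)

Section euclidean_metric.
Context {R : realType} {D : nat}.
Implicit Types (x y z : 'rV[R]_D) (X : set 'rV[R]_D).

Lemma enorm_ge0 x : 0 <= enorm x.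
Proof. exact: sqrtr_ge0. Qed.

Lemma sum_sqr_ge0 x : 0 <= \sum_(k < D) x 0 k ^+ 2.
Proof. by apply: sumr_ge0 => k _; exact: sqr_ge0. Qed.

Lemma sqr_enorm x : enorm x ^+ 2 = \sum_(k < D) x 0 k ^+ 2.
Proof. by rewrite sqr_sqrtr ?sum_sqr_ge0. Qed.

Lemma enorm0 : enorm (0 : 'rV[R]_D) = 0.
Proof. by rewrite /enorm big1 ?sqrtr0// => k _; rewrite mxE expr0n. Qed.

Lemma enormN x : enorm (- x) = enorm x.
Proof. by congr Num.sqrt; apply: eq_bigr => k _; rewrite mxE sqrrN. Qed.

Lemma coord_le_enorm x k : `|x 0 k| <= enorm x.
Proof.
rewrite -(@ler_pXn2r _ 2)// ?nnegrE ?enorm_ge0// sqr_enorm real_normK ?num_real//.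
by rewrite (bigD1 k)//= lerDl sumr_ge0// => i _; exact: sqr_ge0.
Qed.

Lemma enorm_eq0 x : enorm x = 0 -> x = 0.
Proof.
move=> x0; apply/rowP => k; rewrite mxE; apply/eqP; rewrite -normr_le0 -x0.
exact: coord_le_enorm.
Qed.

Lemma cauchy_schwarz x y : \sum_(k < D) x 0 k * y 0 k <= enorm x * enorm y.
Proof.
set s := \sum_(k < D) _.
have [y0|y0] := eqVneq (enorm y) 0.
  by rewrite y0 mulr0 /s big1// => k _; rewrite (enorm_eq0 y0) mxE mulr0.
(* Up to a factor, this sum is the squared norm of the component of [x] orthogonal to [y], cleared
   of denominators. *)
have : 0 <= \sum_(k < D) (x 0 k * enorm y ^+ 2 - y 0 k * s) ^+ 2.
  by apply: sumr_ge0 => k _; exact: sqr_ge0.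
have -> : \sum_(k < D) (x 0 k * enorm y ^+ 2 - y 0 k * s) ^+ 2 =
    enorm y ^+ 2 * ((enorm x * enorm y) ^+ 2 - s ^+ 2).
  transitivity (enorm x ^+ 2 * enorm y ^+ 4 - s * (2 * enorm y ^+ 2 * s)
      + enorm y ^+ 2 * s ^+ 2); last by ring.
  rewrite (sqr_enorm x) {3}(sqr_enorm y) {2}/s !mulr_suml -sumrB -big_split/=.
  by apply: eq_bigr => k _; ring.
rewrite pmulr_rge0 ?exprn_gt0 ?lt0r ?y0 ?enorm_ge0// subr_ge0 => sxy.
have [s0|s0] := leP s 0; first by rewrite (le_trans s0)// mulr_ge0 ?enorm_ge0.
by rewrite -(@ler_pXn2r _ 2) ?nnegrE ?mulr_ge0 ?enorm_ge0// ltW.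
Qed.

Lemma enormD x y : enorm (x + y) <= enorm x + enorm y.
Proof.
rewrite -(@ler_pXn2r _ 2) ?nnegrE ?addr_ge0 ?enorm_ge0// sqr_enorm.
have -> : \sum_(k < D) (x + y) 0 k ^+ 2 =
    enorm x ^+ 2 + 2 * (\sum_(k < D) x 0 k * y 0 k) + enorm y ^+ 2.
  rewrite !sqr_enorm mulr_sumr -!big_split/=.
  by apply: eq_bigr => k _; rewrite mxE; ring.
have := cauchy_schwarz x y; nra.
Qed.

Lemma enorm_le_sum x : enorm x <= \sum_(k < D) `|x 0 k|.
Proof.
rewrite -(@ler_pXn2r _ 2) ?nnegrE ?enorm_ge0 ?sumr_ge0// sqr_enorm.
rewrite [leRHS]expr2 mulr_suml; apply: ler_sum => k _.
rewrite -real_normK ?num_real// expr2 ler_wpM2l// (bigD1 k)//= lerDl.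
by rewrite sumr_ge0.
Qed.

Lemma edist_ge0 x y : 0 <= edist x y.
Proof. exact: enorm_ge0. Qed.

Lemma edistxx x : edist x x = 0.
Proof. by rewrite /edist subrr enorm0. Qed.

Lemma edistC x y : edist x y = edist y x.
Proof. by rewrite /edist -opprB enormN. Qed.

Lemma edist_triangle z x y : edist x y <= edist x z + edist z y.
Proof. by rewrite /edist -(subrKA z) enormD. Qed.

Lemma edist_gt0 x y : x != y -> 0 < edist x y.
Proof.
move=> xy; rewrite lt0r edist_ge0 andbT; apply: contra xy => /eqP/enorm_eq0.
by move/eqP; rewrite subr_eq0.
Qed.

(** The bridge between the coordinatewise topology of row vectors and the Euclidean metric; later
    arguments on open sets and limits go through it. *)
Lemma nbhs_eball x (U : set 'rV[R]_D) :
  nbhs x U <-> exists2 e, 0 < e & eball x e `<=` U.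
Proof.
split=> [[P xP PU]|[e e0 xeU]].
- have {xP} /choice[e eP] k : exists e, 0 < e /\ ball (x 0 k) e `<=` P 0 k.
    by have /nbhs_ballP[e e0 xeP] := xP 0 k; exists e.
  exists (\big[Num.min/1]_k e k).
    by apply/bigmin_gtP; split=> [|k _]; [exact: ltr01|have [] := eP k].
  move=> y xy; apply: PU => i k; rewrite ord1; have [_] := eP k; apply.
  rewrite /ball/= (le_lt_trans _ (lt_le_trans xy _))//.
    by have := coord_le_enorm (x - y) k; rewrite !mxE.
  exact: bigmin_le_cond.
(* [D] coordinates, each off by at most [e / (D + 1)], sum to less than [e]; [D + 1] also keeps the
   quotient meaningful for [D = 0]. *)
- exists (fun i j => ball (x i j) (e / D.+1%:R)) => [i j|y xy].
    by apply: nbhsx_ballx; rewrite divr_gt0.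
  apply: xeU; rewrite /eball/= (le_lt_trans (enorm_le_sum _))//.
  apply: (@le_lt_trans _ _ (\sum_(k < D) e / D.+1%:R)).
    by apply: ler_sum => k _; rewrite !mxE; have := xy 0 k => /ltW.
  rewrite sumr_const card_ord -(mulr_natr _ D) mulrAC -mulrA gtr_pMr//.
  by rewrite ltr_pdivrMr ?mul1r ?ltr_nat.
Qed.

Lemma eball_center x (r : R) : 0 < r -> eball x r x.
Proof. by move=> r0; rewrite /eball/= edistxx. Qed.

Lemma open_eball x (r : R) : open (eball x r).
Proof.
rewrite openE => y xy; apply/nbhs_eball; exists (r - edist x y).
  by rewrite subr_gt0.
move=> z yz; rewrite /eball/= (le_lt_trans (edist_triangle y _ _))//.
by rewrite -ltrBrDl.
Qed.

Lemma nbhs_eball_center x (r : R) : 0 < r -> nbhs x (eball x r).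
Proof. by move=> r0; apply/nbhs_eball; exists r. Qed.

Lemma compact_finite_net X (r : R) : compact X -> 0 < r ->
  exists s : seq 'rV[R]_D,
    (forall y, y \in s -> X y) /\
    forall x, X x -> exists2 y, y \in s & edist y x < r.
Proof.
rewrite compact_cover => cX r0.
have [||E EX XE] := cX 'rV[R]_D X (eball ^~ r).
- by move=> x _; exact: open_eball.
- by move=> x Xx; exists x => //; exact: eball_center.
exists (finmap.enum_fset E); split; first by move=> y /EX; rewrite inE.
by move=> x /XE[y yE yx]; exists y.
Qed.

Lemma compact_edist_bounded X : compact X -> X !=set0 ->
  exists2 d : R, 0 < d & forall x y, X x -> X y -> edist x y <= d.
Proof.
move=> cX [x0 Xx0]; have [s [_ sX]] := compact_finite_net cX ltr01.
exists (2 * (1 + \sum_(y <- s) edist x0 y)).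
  by rewrite mulr_gt0// ltr_pwDl// sumr_ge0// => y _; exact: edist_ge0.
suff H x : X x -> edist x0 x <= 1 + \sum_(y <- s) edist x0 y.
  move=> x y Xx Xy; rewrite (le_trans (edist_triangle x0 _ _))// edistC.
  by have := H _ Xx; have := H _ Xy; lra.
move=> /sX[y ys yx]; rewrite (le_trans (edist_triangle y _ _))// addrC.
rewrite lerD ?(ltW yx)// (perm_big _ (perm_to_rem ys))/= big_cons lerDl.
by rewrite sumr_ge0// => z _; exact: edist_ge0.
Qed.

End euclidean_metric.

(** Covering numbers ask for open sets of a prescribed diameter, so balls can serve as covering sets
    only once their diameter is known exactly. In dimension 0 it would be 0. *)
Lemma diam_eball (R : realType) D (x : 'rV[R]_D) (r : R) : (0 < D)%N -> 0 < r ->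
  diam (eball x r) = (2 * r)%:E.
Proof.
case: D x => // d x _ r0; apply/eqP; rewrite eq_le; apply/andP; split.
  apply: ge_ereal_sup => _ [[y z] [/= xy xz] <-]; rewrite lee_fin.
  rewrite (le_trans (edist_triangle x _ _))// edistC.
  by move: xy xz; rewrite /eball/=; lra.
apply/lee_subgt0Pr => e e0.
(* The antipodal points at distance [t] from the center are [2 * t >= 2 * r - e] apart; the minimum
   with [r] keeps [t] positive. *)
pose t := r - Num.min e r / 2.
have [t0 tr] : 0 < t < r /\ 2 * r - e <= 2 * t.
  by rewrite /t; have [] := ltP e r; lra.
have [t_gt0 t_ltr] := andP t0.
have xt (u : R) : edist x (x + u *: delta_mx 0 0) = `|u|.
  rewrite /edist opprD addrA subrr sub0r enormN /enorm big_ord_recl !mxE/=.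
  rewrite big1 ?addr0 ?mulr1 ?sqrtr_sqr// => k _.
  by rewrite !mxE/= mulr0 expr0n.
apply: (@le_trans _ _ (2 * t)%:E); first by rewrite -EFinB lee_fin.
apply: ereal_sup_ubound; exists (x + (- t) *: delta_mx 0 0, x + t *: delta_mx 0 0).
  by split; rewrite /eball/= xt ?normrN gtr0_norm.
congr EFin; rewrite /= /edist.
have -> : x + (- t) *: delta_mx 0 0 - (x + t *: delta_mx 0 0) =
   x - (x + (2 * t) *: delta_mx 0 0) :> 'rV[R]_d.+1.
  by apply/rowP => k; rewrite !mxE; ring.
by have := xt (2 * t); rewrite /edist => ->; rewrite gtr0_norm ?mulr_gt0.
Qed.

(** * Cylinders *)

Section words.
Context {N : nat}.
Implicit Types (i j : symb N) (A B : set (symb N)) (w : seq 'I_N.+1).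

Lemma size_word_prefix i n : size (word_prefix i n) = n.
Proof. exact: size_mkseq. Qed.

Lemma word_prefixP i j n :
  word_prefix i n = word_prefix j n <-> forall k, (k < n)%N -> i k = j k.
Proof.
split=> [ij k kn|ij].
  by move/(congr1 (fun s => nth ord0 s k)): ij; rewrite !nth_mkseq.
apply: (@eq_from_nth _ ord0) => [|k]; first by rewrite !size_word_prefix.
by rewrite size_word_prefix => kn; rewrite !nth_mkseq// ij.
Qed.

Lemma word_prefix_le i j n m : (n <= m)%N ->
  word_prefix i m = word_prefix j m -> word_prefix i n = word_prefix j n.
Proof.
by move=> nm /word_prefixP ij; apply/word_prefixP => k kn; rewrite ij// (leq_trans kn).
Qed.

Lemma iter_left_shift n i k : iter n left_shift i k = i (n + k)%N.
Proof. by elim: n k => //= n IH k; rewrite /left_shift IH addnS. Qed.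

Lemma word_prefixD i n m :
  word_prefix i (n + m) = word_prefix i n ++ word_prefix (iter n left_shift i) m.
Proof.
rewrite /word_prefix /mkseq iotaD map_cat; congr (_ ++ _).
rewrite add0n -[X in iota X m]addn0 iotaDl -map_comp; apply: eq_map => k /=.
by rewrite iter_left_shift.
Qed.

Lemma cylinder_cat w v :
  cylinder (w ++ v) = cylinder w `&` iter (size w) left_shift @^-1` cylinder v.
Proof.
apply/seteqP; split=> i; rewrite /cylinder/= size_cat word_prefixD.
  move/eqP; rewrite eqseq_cat ?size_word_prefix// => /andP[/eqP ? /eqP ?].
  by split.
by move=> [-> ->].
Qed.

Lemma cylinder_prefixE i n j :
  cylinder (word_prefix i n) j = (word_prefix j n = word_prefix i n).
Proof. by rewrite /cylinder /mkset size_word_prefix. Qed.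

Lemma cylinder_prefix i n : cylinder (word_prefix i n) i.
Proof. by rewrite /cylinder/= size_word_prefix. Qed.

Lemma measurable_cylinder w : measurable (cylinder w).
Proof.
apply: sub_sigma_algebra.
have -> : cylinder w = \bigcap_(k in `I_(size w))
    [set i : symb N | i k = nth ord0 w k].
  apply/seteqP; split=> [i iw k kw|i iw]/=.
    by rewrite -iw nth_mkseq.
  apply: (@eq_from_nth _ ord0) => [|k]; first by rewrite size_word_prefix.
  by rewrite size_word_prefix => kw; rewrite nth_mkseq// iw.
elim: (size w) => [|n IH].
  by rewrite II0 bigcap_set0; exact: openT.
have -> : \bigcap_(k in `I_n.+1) [set i : symb N | i k = nth ord0 w k] =
   (\bigcap_(k in `I_n) [set i : symb N | i k = nth ord0 w k]) `&`
   [set i : symb N | i n = nth ord0 w n].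
  apply/seteqP; split=> i.
    by move=> H; split=> [k kn|]; apply: H => //=; exact: ltnW.
  move=> [H1 H2] k /=; rewrite ltnS leq_eqVlt => /orP[/eqP->//|kn].
  exact: H1.
apply: (@openI (prod_topology (fun _ : nat => discrete_topology 'I_N.+1))) => //.
pose K := fun _ : nat => discrete_topology 'I_N.+1.
apply: ((@continuousP (prod_topology K) (K n) (fun f => f n)).1
  (@proj_continuous nat K n) [set nth ord0 w n]).
exact: discrete_open.
Qed.

Lemma cylinder_trivIset n :
  trivIset setT (fun w : n.-tuple 'I_N.+1 => cylinder w).
Proof.
move=> w v _ _ [i []]; rewrite /cylinder/= !size_tuple => -> wv.
exact: val_inj.
Qed.

Lemma bigcup_cylinder n :
  \bigcup_(w : n.-tuple 'I_N.+1) cylinder w = setT.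
Proof.
apply/seteqP; split=> // i _.
by exists (Tuple (introT eqP (size_word_prefix i n))) => //; exact: cylinder_prefix.
Qed.

Lemma cylinder_open_base (U : set (symb N)) :
  @open (prod_topology (fun _ : nat => discrete_topology 'I_N.+1)) U ->
  forall i, U i -> exists n, cylinder (word_prefix i n) `<=` U.
Proof.
move=> oU i Ui.
pose T := prod_topology (fun _ : nat => discrete_topology 'I_N.+1).
(* The filter generated by the cylinders around [i]. It converges to [i] in the product topology,
   because each coordinate is constant on a long enough cylinder. *)
pose F : set_system T := [set V | exists n, cylinder (word_prefix i n) `<=` V].
have FF : Filter F.
  split.
  - by exists 0%N.
  - move=> P Q [n nP] [m mQ]; exists (maxn n m) => j.
    rewrite cylinder_prefixE => ij.
    split; [apply: nP|apply: mQ]; rewrite cylinder_prefixE;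
      apply: word_prefix_le ij; [exact: leq_maxl|exact: leq_maxr].
  - by move=> P Q PQ [n nP]; exists n; apply: subset_trans PQ.
suff : F --> (i : T).
  by move/(_ U); apply; exact: open_nbhs_nbhs.
apply/cvg_sup => k V; rewrite nbhsE => -[W [[C oC CW] Wi] WV].
exists k.+1 => j; rewrite cylinder_prefixE => /word_prefixP ij.
by apply: WV; move: Wi; rewrite -CW/= ij.
Qed.

(** The members of the finite algebra generated by the cylinders of length [n], described without
    naming the words. *)
Definition determined n A :=
  forall i j, word_prefix i n = word_prefix j n -> A i -> A j.

Lemma determined_cylinder n A (w : n.-tuple 'I_N.+1) i : determined n A ->
  A i -> cylinder w i -> cylinder w `<=` A.
Proof.
move=> dA Ai; rewrite /cylinder/= size_tuple => iw j/= jw.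
by apply: dA Ai; rewrite iw.
Qed.

Lemma determined_cylinderI n A (w : n.-tuple 'I_N.+1) : determined n A ->
  A `&` cylinder w = cylinder w \/ A `&` cylinder w = set0.
Proof.
move=> dA; have [[i [Ai wi]]|Aw] := pselect (A `&` cylinder w !=set0).
  by left; apply/setIidr; exact: determined_cylinder Ai wi.
by right; apply/seteqP; split=> // i Awi; case: Aw; exists i.
Qed.

Lemma determinedC n A : determined n A -> determined n (~` A).
Proof. by move=> dA i j ij nAi Aj; apply: nAi; apply: dA Aj. Qed.

Lemma determinedI n A B : determined n A -> determined n B ->
  determined n (A `&` B).
Proof. by move=> dA dB i j ij [/dA Aj /dB Bj]; split; [exact: Aj|exact: Bj]. Qed.

Lemma determined_le n m A : (n <= m)%N -> determined n A -> determined m A.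
Proof. by move=> nm dA i j /(word_prefix_le nm); exact: dA. Qed.

Lemma determined_shift n m A : determined m A ->
  determined (n + m) (iter n left_shift @^-1` A).
Proof.
move=> dA i j ij; apply: dA; apply/word_prefixP => k km.
rewrite !iter_left_shift; move/word_prefixP: ij; apply.
by rewrite ltn_add2l.
Qed.

Lemma measurable_determined n A : determined n A -> measurable A.
Proof.
move=> dA.
have -> : A = \bigcup_(w in [set w : n.-tuple 'I_N.+1 | cylinder w `<=` A]) cylinder w.
  apply/seteqP; split=> i; last by move=> [w wA]; exact: wA.
  have [w _ wi] : (\bigcup_(w : n.-tuple 'I_N.+1) cylinder w) i.
    by rewrite bigcup_cylinder.
  by move=> Ai; exists w => //=; exact: determined_cylinder Ai wi.
by apply: fin_bigcup_measurable => // w _; exact: measurable_cylinder.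
Qed.

Lemma measurable_left_shift : measurable_fun setT (@left_shift N).
Proof.
apply: (@measurability _ _ (symb N) (symb N) setT (@left_shift N)
  (@open (prod_topology (fun _ : nat => discrete_topology 'I_N.+1)))) => //.
move=> _ [U oU <-]; rewrite setTI.
have -> : left_shift @^-1` U = \bigcup_n \bigcup_(w in
    [set w : n.+1.-tuple 'I_N.+1 | cylinder w `<=` left_shift @^-1` U]) cylinder w.
  apply/seteqP; split=> i; last by move=> [n _ [w wU]]; exact: wU.
  move=> /(cylinder_open_base oU)[n nU]; exists n => //.
  (* One letter more is needed: the first [n] letters of the shifted sequence are the letters 1 to
     [n] of [i]. *)
  exists (Tuple (introT eqP (size_word_prefix i n.+1))); last exact: cylinder_prefix.
  move=> j ij; apply: nU; move: ij.
  rewrite !cylinder_prefixE => /word_prefixP ij; apply/word_prefixP => k kn.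
  by rewrite /left_shift ij.
apply: bigcupT_measurable => n; apply: fin_bigcup_measurable => // w _.
exact: measurable_cylinder.
Qed.

Lemma measurable_iter_left_shift n A : measurable A ->
  measurable (iter n left_shift @^-1` A).
Proof.
move=> mA; elim: n => // n IH.
have -> : iter n.+1 left_shift @^-1` A = left_shift @^-1` (iter n left_shift @^-1` A).
  by apply/seteqP; split=> i /=; rewrite -iterSr.
by rewrite -[_ @^-1` _]setTI; exact: measurable_left_shift.
Qed.

End words.

(** * Measures of cylinders under shift and reversal *)

Section word_measures.
Context {R : realType} {N : nat}.
Implicit Types (mu mur : probability (symb N) R) (A B : set (symb N)).

(** The space is partitioned according to the letters at the positions [k] to [k + n - 1]. *)
Lemma measure_sum_cylinder_shift mu k n A : measurable A ->
  mu A = (\sum_(w : n.-tuple 'I_N.+1)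
            mu (A `&` iter k left_shift @^-1` cylinder w))%E.
Proof.
move=> mA; rewrite -[in LHS](setIT A) -(preimage_setT (iter k left_shift)).
rewrite -(bigcup_cylinder n) preimage_bigcup setI_bigcupr measure_fin_bigcup//.
- rewrite (fsbigE (index_enum _)) ?index_enum_uniq//=.
  + by apply: eq_bigl => w; rewrite in_setT.
  + by move=> w _; rewrite mem_index_enum.
- exact: finite_finset.
- apply: trivIset_setIl => w v _ _ [i [wi vi]].
  by apply: (@cylinder_trivIset N n) => //; exists (iter k left_shift i).
- move=> w _; apply: measurableI => //; apply: measurable_iter_left_shift.
  exact: measurable_cylinder.
Qed.

Lemma measure_sum_cylinder mu n A : measurable A ->
  mu A = (\sum_(w : n.-tuple 'I_N.+1) mu (A `&` cylinder w))%E.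
Proof. exact: (@measure_sum_cylinder_shift mu 0). Qed.

Lemma measure_iter_left_shift mu n A : shift_invariant mu -> measurable A ->
  mu (iter n left_shift @^-1` A) = mu A.
Proof.
move=> muT mA; elim: n => // n <-.
have -> : iter n.+1 left_shift @^-1` A = left_shift @^-1` (iter n left_shift @^-1` A).
  by apply/seteqP; split=> i /=; rewrite -iterSr.
by rewrite muT//; exact: measurable_iter_left_shift.
Qed.

(** Both sides are finite sums over words of length [n], and reversal permutes these words. This
    turns events on orbits into events on the natural projection. *)
Lemma measure_rev mu mur n (V : set (seq 'I_N.+1)) :
  (forall w, mur (cylinder w) = mu (cylinder (rev w))) ->
  mu [set i | V (rev (word_prefix i n))] = mur [set i | V (word_prefix i n)].
Proof.
move=> murE.
rewrite (@measure_sum_cylinder mu n); last first.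
  by apply: (@measurable_determined _ n) => i j /= ->.
rewrite (@measure_sum_cylinder mur n); last first.
  by apply: (@measurable_determined _ n) => i j /= ->.
rewrite (reindex_inj (h := fun w : n.-tuple 'I_N.+1 => [tuple of rev w])); last first.
  by move=> w v /(congr1 val)/= /(congr1 rev); rewrite !revK => /val_inj.
apply: eq_bigr => w _.
have E (W : set (seq 'I_N.+1)) (v : n.-tuple 'I_N.+1) :
    [set i : symb N | W (word_prefix i n)] `&` cylinder v =
    if `[< W v >] then cylinder v else set0.
  apply/seteqP; split=> i /=.
    by case=> Wi; rewrite /cylinder/= size_tuple => iv; rewrite asboolT -?iv.
  by case: asboolP => // Wv; rewrite /cylinder/= size_tuple => ->; split.
rewrite E (E (V \o rev))/= revK.
by case: asboolP => _; rewrite ?measure0// murE.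
Qed.

End word_measures.

(** * Decay of correlations and Borel-Cantelli *)

Section decay.
Context {R : realType} {N : nat}.
Variable mu : probability (symb N) R.
Implicit Types (A B : set (symb N)).

(** Both sides are additive in each of the two sets, so the bound for cylinders extends: first [B]
    is split into cylinders, then [A]. *)
Lemma decay_determined (c : R) n m k A B :
  (forall w v, size w = n -> size v = m ->
    (mu (cylinder w `&` iter k left_shift @^-1` cylinder v) <=
     c%:E * mu (cylinder w) * mu (cylinder v))%E) ->
  0 <= c -> determined n A -> determined m B ->
  (mu (A `&` iter k left_shift @^-1` B) <= c%:E * mu A * mu B)%E.
Proof.
move=> H c0 dA dB.
have mB := measurable_determined dB.
have mTB := measurable_iter_left_shift k mB.
have mA := measurable_determined dA.
have HB w : size w = n ->
    (mu (cylinder w `&` iter k left_shift @^-1` B) <=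
     c%:E * mu (cylinder w) * mu B)%E.
  move=> wn.
  rewrite (@measure_sum_cylinder_shift _ _ mu k m); last first.
    by apply: measurableI => //; exact: measurable_cylinder.
  rewrite (@measure_sum_cylinder _ _ mu m B)// ge0_sume_distrr//.
  apply: lee_sum => v _; rewrite -setIA -preimage_setI.
  have [->|->] := determined_cylinderI v dB.
    by apply: H => //; rewrite size_tuple.
  by rewrite preimage_set0 setI0 !measure0 mule0.
rewrite (@measure_sum_cylinder _ _ mu n); last exact: measurableI.
rewrite (@measure_sum_cylinder _ _ mu n A)// -muleA (muleC (\sum__ _)%E) muleA.
rewrite ge0_sume_distrr//; apply: lee_sum => w _; rewrite setIAC.
have [->|->] := determined_cylinderI w dA.
  by rewrite muleAC HB// size_tuple.
by rewrite set0I !measure0 mule0.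
Qed.

(** Visits to [A] at the first [q] multiples of [L]. The recursion splits off the latest visit, the
    factor to which the decay of correlations applies. *)
Fixpoint recurring (L q : nat) A : set (symb N) :=
  if q is q'.+1 then recurring L q' A `&` iter (q' * L) left_shift @^-1` A
  else setT.

Lemma recurringP L q A i :
  recurring L q A i <-> forall j, (j < q)%N -> A (iter (j * L) left_shift i).
Proof.
elim: q => [|q IH] //=; split=> [[/IH Ai Aqi] j|Ai].
  by rewrite ltnS leq_eqVlt => /orP[/eqP->|/Ai].
by split; [apply/IH => j /ltnW; exact: Ai|exact: Ai].
Qed.

Lemma determined_recurring L q m A : (m <= L)%N -> determined m A ->
  determined (q * L + m) (recurring L q.+1 A).
Proof.
move=> mL dA; elim: q => [|q IH].
  by move=> i j ij [_ Ai]; split => //; apply: dA Ai.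
apply: determinedI; last exact: determined_shift.
apply: determined_le IH.
by rewrite mulSn -addnA leq_addl.
Qed.

(** Each visit after the first contributes a factor [c * mu A <= r], since a gap of [L - m] letters
    separates it from the earlier ones. The first visit is bounded by 1, whence [q] factors for
    [q + 1] visits. *)
Lemma measure_recurring (c r : R) L q m A :
  shift_invariant mu ->
  (forall w v k, (size w + (L - m) <= k)%N ->
    (mu (cylinder w `&` iter k left_shift @^-1` cylinder v) <=
     c%:E * mu (cylinder w) * mu (cylinder v))%E) ->
  0 <= c -> (m <= L)%N -> determined m A -> (c%:E * mu A <= r%:E)%E -> 0 <= r ->
  (mu (recurring L q.+1 A) <= (r ^+ q)%:E)%E.
Proof.
move=> muT H c0 mL dA cAr r0; elim: q => [|q IH].
  by rewrite expr0 probability_le1//;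
    apply: measurable_determined (determined_recurring mL dA).
have dq := determined_recurring mL dA (q := q).
rewrite [recurring _ _ _]/(recurring L q.+1 A `&` iter (q.+1 * L) left_shift @^-1` A).
apply: le_trans (@decay_determined c (q * L + m)%N m (q.+1 * L)%N _ _ _ c0 dq dA) _.
  by move=> w v wn _; apply: H; rewrite wn -addnA subnKC// mulSn addnC.
by rewrite muleAC exprS EFinM lee_pmul// mule_ge0.
Qed.

(** The first Borel-Cantelli lemma, the series being dominated by a geometric one. The sets before
    [k0], which have no bound, are replaced by the empty set. *)
Lemma ae_eventually_not (F : (set (symb N))^nat) (C b : R) k0 :
  (forall k, measurable (F k)) -> 0 < b -> 0 <= C ->
  (forall k, (k0 <= k)%N -> (mu (F k) <= (C * expR (- (b * k%:R)))%:E)%E) ->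
  {ae mu, forall i, exists k1, forall k, (k1 <= k)%N -> ~ F k i}.
Proof.
move=> mF b0 C0 muF.
pose G k := if (k0 <= k)%N then F k else set0.
have mG k : measurable (G k) by rewrite /G; case: ifP.
pose q := expR (- b).
have q0 : 0 < q by exact: expR_gt0.
have q1 : q < 1 by rewrite /q expR_lt1 oppr_lt0.
have geom n : \sum_(0 <= k < n) q ^+ k <= (1 - q)^-1.
  rewrite -[leRHS]mul1r ler_pdivlMr ?subr_gt0// -opprB mulrN mulrC big_mkord -subrX1.
  by rewrite opprB gerBl exprn_ge0// ltW.
have muG : (\sum_(k <oo) mu (G k) < +oo)%E.
  apply: (@le_lt_trans _ _ (C * (1 - q)^-1)%:E); last exact: ltry.
  apply: lime_le; first by apply: is_cvg_nneseries.
  apply: nearW => n; apply: (@le_trans _ _ (\sum_(0 <= k < n) (C * q ^+ k)%:E)%E).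
    apply: lee_sum => k _; rewrite /G; case: ifPn => [k0k|_].
      by rewrite (le_trans (muF _ k0k))// lee_fin -expRM_natr mulNr.
    by rewrite measure0 lee_fin mulr_ge0// exprn_ge0// ltW.
  by rewrite sumEFin lee_fin -mulr_sumr ler_wpM2l.
exists (lim_sup_set G); split.
- by apply: bigcapT_measurable => n; apply: bigcup_measurable => k _.
- exact: lim_sup_set_cvg0.
- move=> i /= Hi n _; apply: contrapT => Gi; apply: Hi; exists (maxn n k0) => k.
  rewrite geq_max => /andP[nk k0k] Fki; apply: Gi; exists k => //.
  by rewrite /G k0k.
Qed.

End decay.

(** * Natural projection and orbits *)

Section ifs_geometry.
Context {R : realType} {D N : nat}.
Variables (f : 'I_N.+1 -> 'rV[R]_D -> 'rV[R]_D) (Lam : set 'rV[R]_D) (a d : R).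
Hypothesis a01 : 0 < a < 1.
Hypothesis f_contr : forall c x y, edist (f c x) (f c y) <= a * edist x y.
Hypothesis Lam_attr : attractor f Lam.
Hypothesis Lam_diam : forall x y, Lam x -> Lam y -> edist x y <= d.
Implicit Types (x y : 'rV[R]_D) (i : symb N) (w : seq 'I_N.+1).

Let a0 : 0 <= a. Proof. by case/andP: a01 => /ltW ->. Qed.

Lemma attractor_word w x : Lam x -> Lam (foldr f x w).
Proof.
move=> Lx; elim: w => //= c w IH; have [_ _ LE] := Lam_attr.
by rewrite LE; exists c => //; exists (foldr f x w).
Qed.

Lemma attractor_word_ex m x : Lam x ->
  exists (w : m.-tuple 'I_N.+1) y, Lam y /\ x = foldr f y w.
Proof.
elim: m x => [|m IH] x Lx; first by exists [tuple of [::]], x.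
have [_ _ LE] := Lam_attr.
have [c _ [y Ly <-]] : (\bigcup_c (f c @` Lam)) x by rewrite -LE.
have [w [z [Lz ->]]] := IH _ Ly.
by exists [tuple of c :: w], z; split.
Qed.

Lemma edist_word w x y :
  edist (foldr f x w) (foldr f y w) <= a ^+ size w * edist x y.
Proof.
elim: w => [|c w IH] /=; first by rewrite mul1r.
by rewrite (le_trans (f_contr _ _ _))// exprS -mulrA ler_wpM2l.
Qed.

Lemma edist_attractor_word w x y : Lam x -> Lam y ->
  edist (foldr f x w) (foldr f y w) <= a ^+ size w * d.
Proof.
move=> Lx Ly; rewrite (le_trans (edist_word _ _ _))// ler_wpM2l ?exprn_ge0//.
exact: Lam_diam.
Qed.

(** The map applied last is outermost, so the final [m] letters act in reverse order on an earlier
    orbit point. This is where the reversed measure comes from. *)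
Lemma orbit_pointE i x n m : (m <= n)%N ->
  orbit_point f i x n =
  foldr f (orbit_point f i x (n - m))
    (rev (word_prefix (iter (n - m) left_shift i) m)).
Proof.
move=> mn; rewrite /orbit_point -{1}(subnK mn) word_prefixD foldl_cat.
by rewrite -[X in foldl _ _ X]revK (foldl_rev (fun y c => f c y)).
Qed.

Lemma attractor_orbit_point i x n : Lam x -> Lam (orbit_point f i x n).
Proof.
move=> Lx; rewrite (@orbit_pointE i x n n)// subnn.
exact: attractor_word.
Qed.

Lemma cvg_expr_mulr (c : R) : (fun n => a ^+ n * c) @ \oo --> (0 : R).
Proof.
rewrite -[X in _ --> X](mul0r c); apply: cvgMl; apply: cvg_expr.
by rewrite ger0_norm//; case/andP: a01.
Qed.

Lemma hausdorff_rV : hausdorff_space 'rV[R]_D.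
Proof.
move=> x y xy; apply/eqP; apply: contrapT => /negP/edist_gt0 xy0.
have e0 : 0 < edist x y / 2 by rewrite divr_gt0.
have [z [/= xz yz]] := xy _ _ (nbhs_eball_center x e0) (nbhs_eball_center y e0).
have := edist_triangle z x y; rewrite (edistC z y).
by move: xz yz; rewrite /eball/=; lra.
Qed.

(** The limit that defines the projection is shown to exist. Started inside [Lam], the compositions
    have a cluster point by compactness; contraction makes it the limit, and forgets whether the
    start is in [Lam] or at the origin. *)
Lemma natural_proj_attractor i :
  Lam (natural_proj f i) /\
  forall n y, Lam y ->
    edist (foldr f y (word_prefix i n)) (natural_proj f i) <= a ^+ n * d.
Proof.
have [[y0 Ly0] cLam _] := Lam_attr.
have [z [Lz z_cluster]] : Lam `&` cluster
    ((fun n => foldr f y0 (word_prefix i n)) @ \oo) !=set0.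
  by apply: cLam; exists 0%N => // n _ /=; exact: attractor_word.
have zP n y : Lam y -> edist (foldr f y (word_prefix i n)) z <= a ^+ n * d.
  move=> Ly; apply/ler_addgt0Pr => e e0.
  (* Some later composition is [e]-close to the cluster point; it shares the first [n] maps with the
     composition at [n]. *)
  have [_ [[k nk <-] zu]] : [set foldr f y0 (word_prefix i k) | k in [set k | (n <= k)%N]]
      `&` eball z e !=set0.
    apply: z_cluster; last exact: nbhs_eball_center.
    by exists n => // k nk; exists k.
  rewrite (le_trans (edist_triangle (foldr f y0 (word_prefix i k)) _ _))//.
  rewrite lerD//; last by rewrite edistC ltW.
  rewrite -(subnKC nk) word_prefixD foldr_cat.
  rewrite -[in leRHS](size_word_prefix i n); apply: edist_attractor_word => //.
  exact: attractor_word.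
suff -> : natural_proj f i = z by [].
apply: cvg_lim; first exact: hausdorff_rV.
move=> U /nbhs_eball[e e0 zU].
have /cvgr0Pnorm_lt := cvg_expr_mulr (edist 0 y0 + d).
move=> /(_ _ e0)[n0 _ n0P]; exists n0 => // n /n0P lt_e.
apply: zU; rewrite /eball/= edistC (le_lt_trans _ lt_e)//.
rewrite (le_trans _ (ler_norm _))//.
rewrite (le_trans (edist_triangle (foldr f y0 (word_prefix i n)) _ _))//.
rewrite mulrDr lerD ?zP//.
by rewrite -[in leRHS](size_word_prefix i n) edist_word.
Qed.

Lemma measurable_preimage_natural_proj (U : set 'rV[R]_D) : 0 < d -> open U ->
  measurable (natural_proj f @^-1` U).
Proof.
move=> d0 oU; have [[y0 Ly0] _ _] := Lam_attr.
(* An open condition on the limit is decided by finitely many letters. The approximation error is at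
   most [a ^+ n * d]; the radius [2 * d] makes the inclusion in the ball strict. *)
have -> : natural_proj f @^-1` U = \bigcup_n [set i |
    eball (foldr f y0 (word_prefix i n)) (a ^+ n * (2 * d)) `<=` U].
  apply/seteqP; split=> [i Ui|i [n _ nU]].
  - have [Li Hi] := natural_proj_attractor i.
    have /nbhs_eball[e e0 eU] : nbhs (natural_proj f i) U by apply: open_nbhs_nbhs.
    have /cvgr0Pnorm_lt/(_ _ e0)[n _ /(_ n (leqnn n)) lt_e] := cvg_expr_mulr (3 * d).
    exists n => // y /= iy; apply: eU; rewrite /eball/=.
    rewrite (le_lt_trans (edist_triangle (foldr f y0 (word_prefix i n)) _ _))//.
    rewrite (lt_le_trans _ (le_trans (ler_norm _) (ltW lt_e)))// edistC.
    rewrite [ltRHS](_ : _ = a ^+ n * d + a ^+ n * (2 * d)); last by ring.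
    by rewrite ler_ltD// Hi.
  - apply: nU; rewrite /eball/=.
    have [_ /(_ n y0 Ly0)/le_lt_trans] := natural_proj_attractor i.
    apply; rewrite ltr_pM2l ?ltr_pMl ?ltr1n// exprn_gt0//.
    by case/andP: a01.
apply: bigcupT_measurable => n; apply: (@measurable_determined _ n).
by move=> i j /= ->.
Qed.

End ifs_geometry.

(** * Cover times *)

Lemma ge_linear_expR (R : realType) (b C : R) : 0 < b ->
  exists y0 : R, forall y : R, y0 <= y -> C * (y + 1) <= expR (b * y).
Proof.
(* The exponential is at least [(1 + b * y / 2) ^+ 2], hence at least [b ^+ 2 * y ^+ 2 / 4], while
   [y + 1 <= 2 * y] for [y >= 1]. *)
move=> b0; exists (Num.max 1 (8 * C / b ^+ 2)) => y.
rewrite ge_max ler_pdivrMr ?exprn_gt0// => /andP[y1 Cy].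
have by0 : 0 <= b * y by nra.
have -> : b * y = b * y / 2 + b * y / 2 by rewrite -splitr.
rewrite expRD; have e1 := expR_ge1Dx (b * y / 2).
apply: (@le_trans _ _ ((1 + b * y / 2) * (1 + b * y / 2))).
  have : 0 <= b ^+ 2 by exact: sqr_ge0.
  by nra.
by apply: ler_pM => //; lra.
Qed.

Lemma ge_expR (R : realType) (b C : R) : 0 < b ->
  exists y0 : R, forall y : R, y0 <= y -> C <= expR (b * y).
Proof.
move=> b0; have [y0 H] := ge_linear_expR `|C| b0; exists (Num.max 0 y0) => y.
rewrite ge_max => /andP[y_ge0 /H]; apply: le_trans.
by rewrite (le_trans (ler_norm _))// ler_peMr//; lra.
Qed.

(** Block lengths proportional to [y] suffice for an error [expR (- (s * y))]. The successor of [m]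
    occurs because [m] will be the integer part of a multiple of [y]. *)
Lemma exprn_le_expR (R : realType) (q s C : R) : 0 < q < 1 -> 0 < C -> 0 <= s ->
  exists2 A : R, 0 < A & exists y0 : R, forall (y : R) (m : nat), y0 <= y ->
    A * y <= m.+1%:R -> C * q ^+ m <= expR (- (s * y)).
Proof.
move=> /andP[q0 q1] C0 s0; have lnq : ln q < 0 by rewrite ln_lt0// q0.
have [y0 H] := @ge_expR _ 1 (C / q) ltr01.
(* The rate [s + 1] instead of [s] leaves a factor [expR (- y)], which absorbs [C / q]. *)
exists ((s + 1) / - ln q); first by rewrite divr_gt0 ?oppr_gt0//; lra.
exists y0 => y m /H; rewrite mul1r => Cy.
rewrite mulrAC ler_pdivrMr ?oppr_gt0// => Am.
have -> : q ^+ m = q ^-1 * q ^+ m.+1 by rewrite exprS mulKf// gt_eqF.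
have -> : q ^+ m.+1 = expR (m.+1%:R * ln q) by rewrite expRM_natl lnK.
rewrite mulrA.
apply: (@le_trans _ _ (expR y * expR (- ((s + 1) * y)))).
  apply: ler_pM => //; rewrite ?expR_ge0 ?ler_expR//.
    by rewrite divr_ge0 ?ltW.
  lra.
by rewrite -expRD ler_expR; lra.
Qed.

Section cover_times.
Context {R : realType} {D N : nat}.
Variables (f : 'I_N.+1 -> 'rV[R]_D -> 'rV[R]_D) (Lam : set 'rV[R]_D).
Hypothesis Lam_attr : attractor f Lam.
Implicit Types (x b : 'rV[R]_D) (i : symb N) (r e : R) (n K : nat).

(** Orbit points lie in [Lam], so only one half of the Hausdorff distance has to be bounded. The gap
    [e < r] keeps the inequality strict after the supremum. *)
Lemma cover_time_le i x r e n : Lam x -> 0 <= e -> e < r ->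
  (forall b, Lam b -> exists2 j, (j <= n)%N & edist b (orbit_point f i x j) <= e) ->
  (cover_time f Lam i x r <= (n%:R)%:E)%E.
Proof.
move=> Lx e0 er H; apply: ereal_inf_lbound; exists n => //=.
rewrite /hausdorff_dist gt_max; apply/andP; split.
  apply: (@le_lt_trans _ _ e%:E); last by rewrite lte_fin.
  apply: ge_ereal_sup => _ [_ [j /= jn <-] <-].
  apply: ereal_inf_le; exists (0 : \bar R); last by rewrite lee_fin.
  exists (orbit_point f i x j); first exact: attractor_orbit_point.
  by rewrite edistxx.
apply: (@le_lt_trans _ _ e%:E); last by rewrite lte_fin.
apply: ge_ereal_sup => _ [b Lb <-]; have [j jn bj] := H b Lb.
apply: ereal_inf_le; exists (edist b (orbit_point f i x j))%:E; last by rewrite lee_fin.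
by exists (orbit_point f i x j) => //; exists j.
Qed.

(** One point [b] that the orbit has not approached already bounds the Hausdorff distance from
    below. *)
Lemma cover_time_gt i x r b K : Lam b ->
  (forall j, (j <= K)%N -> r <= edist b (orbit_point f i x j)) ->
  ((K.+1%:R)%:E <= cover_time f Lam i x r)%E.
Proof.
move=> Lb H; apply: le_ereal_inf_tmp => _ [n /= nr <-]; rewrite lee_fin ler_nat.
rewrite ltnNge; apply/negP => nK; move: nr.
rewrite /hausdorff_dist gt_max => /andP[_]; apply/negP; rewrite -leNgt.
apply: (@le_trans _ _ (dist_to b (ifs_orbit f i x n))); last first.
  by apply: ereal_sup_ubound; exists b.
apply: le_ereal_inf_tmp => _ [_ [j /= jn <-] <-]; rewrite lee_fin H//.
exact: leq_trans nK.
Qed.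

End cover_times.

(** * Upper bounds on cover times *)

Lemma measure_bigcup_fin_le d (T : measurableType d) (R : realType)
    (mu : {measure set T -> \bar R}) (I : finType) (F : I -> set T) (r : R) :
  (forall v, measurable (F v)) -> (forall v, (mu (F v) <= r%:E)%E) ->
  (mu (\bigcup_v F v) <= (#|I|%:R * r)%:E)%E.
Proof.
move=> mF muF.
have fI : finite_set [set: I] by exact: finite_finset.
apply: (@le_trans _ _ (\sum_(v : I) mu (F v))%E); last first.
  apply: (@le_trans _ _ (\sum_(v : I) r%:E)%E); first by apply: lee_sum => v _.
  by rewrite sumEFin lee_fin sumr_const mulr_natl cardT.
have -> : (\sum_(v : I) mu (F v) = \sum_(v \in [set: I]) mu (F v))%E.
  rewrite (fsbigE (index_enum _)) ?index_enum_uniq//=.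
    by apply: eq_bigl => v; rewrite in_setT.
  by move=> v _; rewrite mem_index_enum.
by apply: content_sub_fsum => //; exact: fin_bigcup_measurable.
Qed.

Lemma exists_nat_ge (R : archiRealFieldType) (x : R) : exists n : nat, x <= n%:R.
Proof.
exists (Num.bound `|x|); rewrite (le_trans (ler_norm x))// ltW//.
exact: archi_boundP.
Qed.

(** * Visits to balls as events on blocks of letters *)

Section hitting.
Context {R : realType} {D N : nat}.
Variables (f : 'I_N.+1 -> 'rV[R]_D -> 'rV[R]_D) (Lam : set 'rV[R]_D) (a d : R).
Hypothesis a01 : 0 < a < 1.
Hypothesis f_contr : forall c x y, edist (f c x) (f c y) <= a * edist x y.
Hypothesis Lam_attr : attractor f Lam.
Hypothesis d0 : 0 < d.
Hypothesis Lam_diam : forall x y, Lam x -> Lam y -> edist x y <= d.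
Variables mu mur : probability (symb N) R.
Hypothesis murE : forall w, mur (cylinder w) = mu (cylinder (rev w)).
Let nu := pushforward mur (natural_proj f).

(** The image of [Lam] under the first [m] maps, applied in the order of the orbit, meets the ball.
    Unlike a visit of the orbit itself, this depends neither on the starting point nor on further
    letters. *)
Definition hit (e : R) (x : 'rV[R]_D) m : set (symb N) :=
  [set i | exists2 z, Lam z & edist x (foldr f z (rev (word_prefix i m))) < e].

Lemma determined_hit e x m : determined m (hit e x m).
Proof. by move=> i j ij [z Lz xz]; exists z => //; rewrite -ij. Qed.

Lemma measurable_hit e x m : measurable (hit e x m).
Proof. by apply: (@measurable_determined _ m); exact: determined_hit. Qed.

Lemma measure_hit e x m : mu (hit e x m) =
  mur [set i | exists2 z, Lam z & edist x (foldr f z (word_prefix i m)) < e].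
Proof.
exact: (measure_rev m [set w | exists2 z, Lam z & edist x (foldr f z w) < e] murE).
Qed.

Lemma preimage_eball_attractor x (r : R) :
  natural_proj f @^-1` (eball x r `&` Lam) = natural_proj f @^-1` (eball x r).
Proof.
apply/seteqP; split=> i; first by case.
move=> ?; split=> //.
by have [] := natural_proj_attractor a01 f_contr Lam_attr Lam_diam i.
Qed.

Lemma measurable_preimage_eball x (r : R) :
  measurable (natural_proj f @^-1` (eball x r `&` Lam)).
Proof.
rewrite preimage_eball_attractor.
apply: (measurable_preimage_natural_proj a01 f_contr Lam_attr Lam_diam d0).
exact: open_eball.
Qed.

Lemma measurable_hit_forward e x m : measurable
  [set i : symb N | exists2 z, Lam z & edist x (foldr f z (word_prefix i m)) < e].
Proof.
by apply: (@measurable_determined _ m) => i j ij [z Lz xz]; exists z => //; rewrite -ij.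
Qed.

(** After reversal, the block gives a composition whose values on [Lam] are within [a ^+ m * d] of
    the projected point; the radius absorbs this error, here and in the converse bound. *)
Lemma measure_hit_ge r e x m : a ^+ m * d <= e ->
  (nu (eball x r `&` Lam) <= mu (hit (r + e) x m))%E.
Proof.
move=> ade; rewrite measure_hit /nu /pushforward; apply: le_measure; rewrite ?inE.
- exact: measurable_preimage_eball.
- exact: measurable_hit_forward.
move=> i [/= xi _]; have [[y Ly] _ _] := Lam_attr; exists y => //.
rewrite (le_lt_trans (edist_triangle (natural_proj f i) _ _))// ltr_leD//.
have [_ H] := natural_proj_attractor a01 f_contr Lam_attr Lam_diam i.
by rewrite edistC (le_trans (H m y Ly)).
Qed.

Lemma measure_hit_le r e x m : a ^+ m * d <= e ->
  (mu (hit r x m) <= nu (eball x (r + e) `&` Lam))%E.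
Proof.
move=> ade; rewrite measure_hit /nu /pushforward; apply: le_measure; rewrite ?inE.
- exact: measurable_hit_forward.
- exact: measurable_preimage_eball.
move=> i [y Ly xy].
have [Li H] := natural_proj_attractor a01 f_contr Lam_attr Lam_diam i; split => //.
rewrite /eball/= (le_lt_trans (edist_triangle (foldr f y (word_prefix i m)) _ _))//.
by rewrite ltr_leD// (le_trans (H m y Ly)).
Qed.

Section upper_bound.
Hypothesis mu_inv : shift_invariant mu.
Hypothesis mu_decay : one_sided_exp_decay mu.

(** The decay with [q] equal to 2 to the power [- eps], made uniform over all gaps of length at
    least [g]. *)
Lemma decay_gap : exists kappa q : R, [/\ 0 < kappa, 0 < q < 1 &
  forall g w v k, (size w + g <= k)%N ->
    (mu (cylinder w `&` iter k left_shift @^-1` cylinder v) <=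
     (1 + kappa * q ^+ g)%:E * mu (cylinder w) * mu (cylinder v))%E].
Proof.
have [eps [kappa [eps0 kappa0 H]]] := mu_decay.
have q01 : 0 < (2 : R) `^ (- eps) < 1.
  rewrite powR_gt0//= /powR ifF ?gt_eqF// expR_lt1 mulNr oppr_lt0 mulr_gt0//.
  by rewrite ln_gt0// ltr1n.
exists kappa, (2 `^ (- eps)); split => // g w v k wgk.
have wk : (size w <= k)%N by rewrite (leq_trans _ wgk)// leq_addr.
apply: (le_trans (H w v k wk)); rewrite lee_wpmul2r// lee_wpmul2r// lee_fin.
rewrite lerD2l ler_wpM2l ?(ltW kappa0)// powRrM powR_mulrn ?powR_ge0//.
case/andP: q01 => q0 q1; apply: ler_wiXn2l; rewrite ?(ltW q0) ?(ltW q1)//.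
by rewrite leq_subRL.
Qed.

Lemma measure_avoid_le (kappa q p e : R) x m n :
  0 < kappa -> 0 < q < 1 ->
  (forall w v k, (size w + m <= k)%N ->
    (mu (cylinder w `&` iter k left_shift @^-1` cylinder v) <=
     (1 + kappa * q ^+ m)%:E * mu (cylinder w) * mu (cylinder v))%E) ->
  0 <= p -> kappa * q ^+ m <= p / 2 -> (p%:E <= mu (hit e x m))%E ->
  (mu (recurring (m + m) n.+1 (~` hit e x m)) <= (expR (- (p / 2 * n%:R)))%:E)%E.
Proof.
move=> kappa0 /andP[q0 q1] H p0 qp pmu.
have p1 : p <= 1.
  by rewrite -lee_fin (le_trans pmu)// probability_le1//; exact: measurable_hit.
have kq0 : 0 <= kappa * q ^+ m by rewrite mulr_ge0 ?exprn_ge0// ltW.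
(* Each further miss costs a factor at most [(1 + p / 2) * (1 - p) <= 1 - p / 2], which is at most
   [expR (- (p / 2))]. *)
apply: (@le_trans _ _ ((1 - p / 2) ^+ n)%:E).
  apply: (@measure_recurring _ _ mu (1 + kappa * q ^+ m) _ _ _ m) => //.
  - by rewrite addnK.
  - by rewrite addr_ge0.
  - exact: leq_addr.
  - exact/determinedC/determined_hit.
  - rewrite probability_setC; last exact: measurable_hit.
    have /fineK hE := fin_num_measure mu _ (measurable_hit e x m).
    move: pmu; rewrite -hE lee_fin => ph.
    by rewrite -EFinB -EFinM lee_fin; nra.
  - by lra.
rewrite lee_fin -[X in expR X]mulNr expRM_natr lerXn2r ?nnegrE ?expR_ge0//; first by lra.
by rewrite (le_trans _ (expR_ge1Dx _))//; lra.
Qed.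

(** The scales [y] may be sparse, as the lower dimension controls only a sequence of radii;
    [k <= y k] makes the exceptional probabilities summable. *)
Lemma ae_cover_time_le (s t c : R) (y : nat -> R) :
  0 <= s -> s < t -> 0 < c -> (forall k, k%:R <= y k) ->
  (forall k x, Lam x ->
    ((c * expR (- (s * y k)))%:E <= nu (eball x (expR (- y k)) `&` Lam))%E) ->
  {ae mu, forall i, exists k1, forall k, (k1 <= k)%N -> forall x, Lam x ->
    (cover_time f Lam i x (4 * expR (- y k)) <= (expR (t * y k))%:E)%E}.
Proof.
move=> s0 st c0 ky nuc; have [[x0 Lx0] _ _] := Lam_attr.
have [kappa [q [kappa0 q01 dec]]] := decay_gap.
have [A1 A1_gt0 [y1 H1]] := exprn_le_expR a01 (mulr_gt0 (ltr0n R 2) d0) ler01.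
have kc0 : 0 < 2 * kappa / c by rewrite divr_gt0// mulr_gt0.
have [A2 A2_gt0 [y2 H2]] := exprn_le_expR q01 kc0 s0.
(* With blocks of length about [A * y], both the diameter error and the correlation error are small.
   Half of [t - s] makes the number of trials exceed [1 / p], the other half pays for the length of
   blocks and gaps. *)
pose A := A1 + A2; pose delta := (t - s) / 2; pose lN := ln (N.+1%:R : R).
have lN0 : 0 <= lN by rewrite ln_ge0// ler1n.
have A_gt0 : 0 < A by rewrite addr_gt0.
have delta0 : 0 < delta by rewrite divr_gt0// subr_gt0.
(* The term [3 * A] bounds the total time, [1] absorbs the rounding of the number of trials, and the
   last term beats the number of words together with the factor [expR (- k)]. *)
have [y3 H3] := ge_linear_expR (3 * A + 1 + 2 / c * (A * lN + 1)) delta0.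
have [k0 k0P] := exists_nat_ge (Num.max y1 (Num.max y2 y3)).
pose m k := Num.truncn (A * y k).
pose n k := Num.truncn (expR ((s + delta) * y k)).
pose X k (v : (m k).-tuple 'I_N.+1) := foldr f x0 v.
(* The bad event: some point of the net indexed by words is missed by all [n k + 1] blocks. *)
pose F k := \bigcup_(v : (m k).-tuple 'I_N.+1)
  recurring (m k + m k) (n k).+1 (~` hit (2 * expR (- y k)) (X k v) (m k)).
have y_ge0 k : 0 <= y k by rewrite (le_trans _ (ky k)).
have mF k v : measurable
    (recurring (m k + m k) (n k).+1 (~` hit (2 * expR (- y k)) (X k v) (m k))).
  apply: measurable_determined; apply: (@determined_recurring _ _ _ (m k)).
    exact: leq_addr.
  exact/determinedC/determined_hit.
have large k : (k0 <= k)%N -> [/\ y1 <= y k, y2 <= y k & y3 <= y k].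
  move=> k0k; have : Num.max y1 (Num.max y2 y3) <= y k.
    by rewrite (le_trans k0P)// (le_trans _ (ky k))// ler_nat.
  by rewrite !ge_max => /and3P.
have mP k : (m k)%:R <= A * y k < (m k).+1%:R.
  by apply: truncn_itv; rewrite mulr_ge0// ltW.
have nP k : (n k)%:R <= expR ((s + delta) * y k) < (n k).+1%:R.
  by apply: truncn_itv; rewrite expR_ge0.
have adm k : (k0 <= k)%N -> a ^+ m k * d <= expR (- y k) / 2.
  move=> /large[y1k _ _]; have := H1 (y k) (m k) y1k; rewrite mul1r.
  have /andP[_ mk] := mP k.
  have -> : A1 * y k <= (m k).+1%:R.
    by rewrite (le_trans _ (ltW mk))// ler_wpM2r// lerDl ltW.
  by move=> /(_ isT); lra.
have muF k : (k0 <= k)%N -> (mu (F k) <= (1 * expR (- (1 * k%:R)))%:E)%E.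
  move=> k0k; have [y1k y2k y3k] := large k k0k.
  pose p := c * expR (- (s * y k)).
  apply: (@le_trans _ _ (N.+1%:R ^+ m k * expR (- (p / 2 * (n k)%:R)))%:E).
    rewrite -natrX -[in X in X%:R](card_ord N.+1) -(card_tuple (m k)).
    apply: measure_bigcup_fin_le => v; first exact: mF.
    apply: (@measure_avoid_le _ _ p (2 * expR (- y k)) (X k v) (m k) (n k)
      kappa0 q01) => //.
    - by move=> w u l; exact: dec.
    - by rewrite mulr_ge0 ?expR_ge0// ltW.
    - have := H2 (y k) (m k) y2k; have /andP[_ mk] := mP k.
      have -> : A2 * y k <= (m k).+1%:R.
        by rewrite (le_trans _ (ltW mk))// ler_wpM2r// lerDr ltW.
      move=> /(_ isT)/(ler_wpM2l (ltW c0)).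
      have -> : c * (2 * kappa / c * q ^+ m k) = 2 * (kappa * q ^+ m k).
        by field; rewrite gt_eqF.
      by rewrite /p; lra.
    - have -> : 2 * expR (- y k) = expR (- y k) + expR (- y k) by ring.
      apply: le_trans (nuc k (X k v) _) _; first exact: attractor_word.
      apply: measure_hit_ge; rewrite (le_trans (adm k k0k))//.
      by have := expR_gt0 (- y k); lra.
  rewrite lee_fin mul1r mul1r.
  have -> : N.+1%:R ^+ m k = expR ((m k)%:R * lN) by rewrite expRM_natl lnK// posrE ltr0n.
  rewrite -expRD ler_expR.
  have : k%:R <= y k by exact: ky.
  have : (m k)%:R * lN <= A * y k * lN.
    by rewrite ler_wpM2r//; have /andP[] := mP k.
  suff : A * y k * lN + y k <= p / 2 * (n k)%:R by lra.
  have n1 : expR ((s + delta) * y k) - 1 <= (n k)%:R.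
    by have /andP[_] := nP k; rewrite -natr1; lra.
  have p_gt0 : 0 < p by rewrite mulr_gt0 ?expR_gt0.
  have p_le : p <= c.
    rewrite /p ler_piMr ?(ltW c0)// -expR0 ler_expR oppr_le0 mulr_ge0//.
  apply: (@le_trans _ _ (p / 2 * (expR ((s + delta) * y k) - 1))); last first.
    by rewrite ler_wpM2l// divr_ge0// ltW.
  have pE : p * expR ((s + delta) * y k) = c * expR (delta * y k).
    by rewrite /p -mulrA -expRD; congr (c * expR _); ring.
  have := H3 _ y3k; set E := expR (delta * y k) in pE * => HE.
  have : c * ((3 * A + 1 + 2 / c * (A * lN + 1)) * (y k + 1)) <= c * E.
    by rewrite ler_wpM2l// ltW.
  have -> : c * ((3 * A + 1 + 2 / c * (A * lN + 1)) * (y k + 1)) =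
     c * (3 * A) * (y k + 1) + c * (y k + 1) + 2 * (A * lN + 1) * (y k + 1).
    by field; rewrite gt_eqF.
  have : 0 <= c * (3 * A) * (y k + 1) by rewrite !mulr_ge0 ?addr_ge0// ltW.
  have : 0 <= c * y k by rewrite mulr_ge0// ltW.
  have : 0 <= A * lN by rewrite mulr_ge0// ltW.
  have := y_ge0 k; move: pE p_le; lra.
have mFk k : measurable (F k).
  by apply: fin_bigcup_measurable => //; exact: finite_finset.
apply: filterS (ae_eventually_not mFk ltr01 ler01 muF) => i [k1 k1P].
exists (maxn k0 k1) => k; rewrite geq_max => /andP[k0k k1k] x Lx.
have [_ _ y3k] := large k k0k.
have hitv v : exists2 j, (j <= n k)%N &
    hit (2 * expR (- y k)) (X k v) (m k) (iter (j * (m k + m k)) left_shift i).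
  apply: contrapT => Hv; apply: (k1P k k1k); exists v => //.
  by apply/recurringP => j; rewrite ltnS => jn hj; apply: Hv; exists j.
apply: (@le_trans _ _ (n k * (m k + m k) + m k)%:R%:E).
  (* The error 3 is the sum of 1/2 from [b] to the net, 2 from the hit, and 1/2 for the diameter of
     the image of [Lam] that contains the orbit point. *)
  apply: (@cover_time_le _ _ _ _ _ Lam_attr _ _ _ (3 * expR (- y k))) => //.
    by rewrite ltr_pM2r ?expR_gt0// ltr_nat.
  move=> b Lb; have [v [z [Lz bE]]] := attractor_word_ex Lam_attr (m k) Lb.
  have [j jn [u Lu vu]] := hitv v.
  (* The orbit is read at the end of the successful block, when its [m k] letters have acted. *)
  exists (j * (m k + m k) + m k)%N; first by rewrite leq_add2r leq_mul2r jn orbT.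
  rewrite (@orbit_pointE _ _ _ _ _ _ _ (m k)) ?leq_addl// addnK.
  set w := rev _ in vu *.
  rewrite (le_trans (edist_triangle (X k v) _ _))//.
  have bX : edist b (X k v) <= expR (- y k) / 2.
    rewrite bE (le_trans (edist_attractor_word a01 f_contr Lam_diam v Lz Lx0))//.
    by rewrite size_tuple adm.
  set o := orbit_point _ _ _ _.
  have := edist_triangle (foldr f u w) (X k v) (foldr f o w).
  have Lo : Lam o by exact: attractor_orbit_point.
  have := edist_attractor_word a01 f_contr Lam_diam w Lu Lo.
  rewrite size_rev size_word_prefix; have := adm k k0k.
  by move: bX vu; lra.
rewrite lee_fin natrD natrM natrD.
have /andP[nk _] := nP k; have /andP[mk _] := mP k.
have -> : t * y k = (s + delta) * y k + delta * y k by rewrite /delta; field.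
rewrite expRD; have := H3 _ y3k.
have : 1 <= expR ((s + delta) * y k).
  by rewrite -[leLHS]expR0 ler_expR mulr_ge0// addr_ge0// ltW.
move: nk; set E := expR _; set G := expR _ => nk E1 HG.
have G3 : 3 * A * y k <= G.
  apply: le_trans HG; have : 0 <= 2 / c * (A * lN + 1) * (y k + 1).
    by rewrite !mulr_ge0 ?addr_ge0 ?mulr_ge0 ?invr_ge0// ltW.
  by have := y_ge0 k; move: A_gt0; lra.
apply: (@le_trans _ _ (E * (3 * (m k)%:R))).
  have := ler_wpM2l (ler0n R (m k)) nk; have := ler_wpM2l (ler0n R (m k)) E1.
  by lra.
apply: ler_pM => //; first lra.
by have := ler0n R (m k); lra.
Qed.

End upper_bound.

End hitting.

(** * Lower bounds on cover times *)

Section escaping.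
Context {R : realType} {D : nat}.
Variables (Lam : set 'rV[R]_D) (alpha C : R).
Hypothesis covering : forall (r R0 : R) x, 0 < r -> r < R0 ->
  (R0%:E <= diam Lam)%E -> Lam x ->
  ((C * (R0 / r) `^ alpha)%:E <= covering_number r (eball x R0 `&` Lam))%E.

(** Otherwise the [m] balls of radius [r] around the points [o j], which have diameter [2 * r],
    would cover the part of [Lam] in the ball, against the lower dimension bound. *)
Lemma exists_far_from_orbit (r R0 : R) x m (o : nat -> 'rV[R]_D) :
  (0 < D)%N -> 0 < r -> 2 * r < R0 -> (R0%:E <= diam Lam)%E -> Lam x ->
  m%:R < C * (R0 / (2 * r)) `^ alpha ->
  exists b, [/\ Lam b, edist x b < R0 &
    forall j, (j < m)%N -> r <= edist (o j) b].
Proof.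
move=> D0 r0 rR RL Lx mC; apply: contrapT => H.
have r20 : 0 < 2 * r by rewrite mulr_gt0.
have := covering r20 rR RL Lx; apply/negP; rewrite -ltNge.
apply: (@le_lt_trans _ _ (m%:R)%:E); last by rewrite lte_fin.
apply: ereal_inf_lbound; exists m => //=; exists (fun k => eball (o k) r); split.
  by move=> k; split; [exact: open_eball|exact: diam_eball].
move=> b [xb Lb]; apply: contrapT => Hb; apply: H; exists b; split => // j jm.
rewrite leNgt; apply/negP => ob; by apply: Hb; exists (Ordinal jm).
Qed.

End escaping.

Section lower_bound.
Context {R : realType} {D N : nat}.
Variables (f : 'I_N.+1 -> 'rV[R]_D -> 'rV[R]_D) (Lam : set 'rV[R]_D) (a d : R).
Hypothesis a01 : 0 < a < 1.
Hypothesis f_contr : forall c x y, edist (f c x) (f c y) <= a * edist x y.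
Hypothesis Lam_attr : attractor f Lam.
Hypothesis d0 : 0 < d.
Hypothesis Lam_diam : forall x y, Lam x -> Lam y -> edist x y <= d.
Variables (alpha C : R).
Hypotheses (alpha0 : 0 < alpha) (C0 : 0 < C).
Hypothesis covering : forall (r R0 : R) x, 0 < r -> r < R0 ->
  (R0%:E <= diam Lam)%E -> Lam x ->
  ((C * (R0 / r) `^ alpha)%:E <= covering_number r (eball x R0 `&` Lam))%E.
Hypothesis Lam_nontrivial : exists x y, [/\ Lam x, Lam y & x != y].
Variables mu mur : probability (symb N) R.
Hypothesis murE : forall w, mur (cylinder w) = mu (cylinder (rev w)).
Hypothesis mu_inv : shift_invariant mu.
Let nu := pushforward mur (natural_proj f).

Lemma dim_gt0 : (0 < D)%N.
Proof.
have [x [y [_ _]]] := Lam_nontrivial; case: (D) x y => // x y.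
by rewrite (thinmx0 x) (thinmx0 y) eqxx.
Qed.

Lemma le_expR_diam : exists y0 : R, forall y : R, y0 <= y ->
  ((expR (- y))%:E <= diam Lam)%E.
Proof.
have [x [y [Lx Ly /edist_gt0 xy]]] := Lam_nontrivial.
have [y0 H] := ge_expR (edist x y)^-1 ltr01; exists y0 => z /H; rewrite mul1r => e.
apply: (@le_trans _ _ (edist x y)%:E); last first.
  by apply: ereal_sup_ubound; exists (x, y).
by rewrite lee_fin expRN invf_ple ?posrE ?expR_gt0.
Qed.

(** Balls of small measure are rarely entered after the first [m] steps, and the positive lower
    dimension deals with those first steps. The price is the smaller radius with exponent
    [1 + delta]. *)
Lemma ae_cover_time_ge (s t delta : R) (y : nat -> R) (x : nat -> 'rV[R]_D) :
  0 <= t -> t < s -> 0 < delta -> (forall k, k%:R <= y k) ->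
  (forall k, Lam (x k)) ->
  (forall k, (nu (eball (x k) (expR (- y k)) `&` Lam) <= (expR (- (s * y k)))%:E)%E) ->
  {ae mu, forall i, exists k1, forall k, (k1 <= k)%N -> forall x0, Lam x0 ->
    ((expR (t * y k))%:E <= cover_time f Lam i x0 (expR (- ((1 + delta) * y k))))%E}.
Proof.
move=> t0 ts delta0 ky Lx nux.
have d40 : 0 < 4 * d by rewrite mulr_gt0.
have [A A_gt0 [y1 H1]] := exprn_le_expR a01 d40 ler01.
have C40 : 0 < C * 4^-1 `^ alpha by rewrite mulr_gt0// powR_gt0 ?invr_gt0.
(* Chosen so that the initial orbit segment, of at most [A * y] points, is shorter than the covering
   number for the radius ratio [expR (delta * y) / 4]. *)
have [y2 H2] := @ge_linear_expR _ (alpha * delta) ((A + 1) / (C * 4^-1 `^ alpha))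
  (mulr_gt0 alpha0 delta0).
have [y3 H3] := le_expR_diam.
have [y4 H4] := ge_expR 5 delta0.
have [k0 k0P] := exists_nat_ge (Num.max (Num.max y1 y2) (Num.max y3 y4)).
pose m k := Num.truncn (A * y k).
pose K k := Num.truncn (expR (t * y k)).
pose rho k := expR (- y k).
(* The bad event: some block starting by time [K k] hits the ball. The radius [3 / 4 * rho] plus the
   diameter error [rho / 4] gives [rho]. *)
pose F k := \bigcup_(n : 'I_(K k).+1)
  iter n left_shift @^-1` hit f Lam (3 / 4 * rho k) (x k) (m k).
have rho_gt0 k : 0 < rho k by exact: expR_gt0.
have y_ge0 k : 0 <= y k by rewrite (le_trans _ (ky k)).
have mF k (n : 'I_(K k).+1) : measurable
    (iter n left_shift @^-1` hit f Lam (3 / 4 * rho k) (x k) (m k)).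
  by apply: measurable_iter_left_shift; exact: measurable_hit.
have large k : (k0 <= k)%N -> [/\ y1 <= y k, y2 <= y k, y3 <= y k & y4 <= y k].
  move=> k0k; have : Num.max (Num.max y1 y2) (Num.max y3 y4) <= y k.
    by rewrite (le_trans k0P)// (le_trans _ (ky k))// ler_nat.
  by rewrite !ge_max -andbA => /and4P.
have mP k : (m k)%:R <= A * y k < (m k).+1%:R.
  by apply: truncn_itv; rewrite mulr_ge0// ltW.
have KP k : (K k)%:R <= expR (t * y k) < (K k).+1%:R.
  by apply: truncn_itv; rewrite expR_ge0.
have adm k : (k0 <= k)%N -> a ^+ m k * d <= rho k / 4.
  move=> /large[y1k _ _ _]; have := H1 (y k) (m k) y1k; rewrite mul1r.
  have /andP[_ /ltW ->] := mP k.
  by move=> /(_ isT); rewrite /rho; lra.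
have muF k : (k0 <= k)%N -> (mu (F k) <= (2 * expR (- ((s - t) * k%:R)))%:E)%E.
  move=> k0k; apply: (@le_trans _ _ ((K k).+1%:R * expR (- (s * y k)))%:E).
    rewrite -[in X in X%:R](card_ord (K k).+1).
    apply: measure_bigcup_fin_le => n; first exact: mF.
    have mH := measurable_hit f Lam (3 / 4 * rho k) (x k) (m k).
    apply: (@le_trans _ _ (mu (hit f Lam (3 / 4 * rho k) (x k) (m k)))).
      by rewrite -(measure_iter_left_shift n mu_inv mH).
    apply: le_trans (nux k).
    rewrite [X in eball _ X](_ : _ = 3 / 4 * rho k + rho k / 4); last first.
      by rewrite /rho; field.
    exact: (measure_hit_le a01 f_contr Lam_attr d0 Lam_diam murE _ _ (adm k k0k)).
  rewrite lee_fin; have /andP[Kk _] := KP k.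
  apply: (@le_trans _ _ (2 * expR (t * y k) * expR (- (s * y k)))).
    rewrite ler_wpM2r ?expR_ge0// -natr1.
    have : 1 <= expR (t * y k) by rewrite -[leLHS]expR0 ler_expR mulr_ge0.
    by lra.
  rewrite -mulrA -expRD ler_wpM2l// ler_expR.
  have : (s - t) * k%:R <= (s - t) * y k by rewrite ler_wpM2l// subr_ge0 ltW.
  by lra.
have mFk k : measurable (F k).
  by apply: fin_bigcup_measurable => //; exact: finite_finset.
have st0 : 0 < s - t by rewrite subr_gt0.
apply: filterS (ae_eventually_not mFk st0 (ler0n _ 2) muF) => i [k1 k1P].
exists (maxn k0 k1) => k; rewrite geq_max => /andP[k0k k1k] x0 Lx0.
have [y1k y2k y3k y4k] := large k k0k.
pose r := expR (- ((1 + delta) * y k)).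
have rE : r = rho k * expR (- (delta * y k)).
  by rewrite /r /rho -expRD; congr expR; ring.
have r_gt0 : 0 < r by exact: expR_gt0.
have r5 : 5 * r <= rho k.
  rewrite rE mulrCA ger_pMr// expRN ler_pdivrMr ?expR_gt0// mul1r.
  exact: H4.
(* The point [b] avoids the orbit before time [m k]. Being within [rho / 2] of the center, it also
   avoids later orbit points: one closer than [r <= rho / 5] would cause a hit. *)
have [b [Lb xb ob]] : exists b, [/\ Lam b, edist (x k) b < rho k / 2 &
    forall j, (j < m k)%N -> r <= edist (orbit_point f i x0 j) b].
  apply: (exists_far_from_orbit covering) => //.
  - exact: dim_gt0.
  - by lra.
  - apply: le_trans (H3 _ y3k); rewrite lee_fin -/(rho k).
    by have := rho_gt0 k; lra.
  have -> : rho k / 2 / (2 * r) = 4^-1 * expR (delta * y k).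
    rewrite rE expRN; field.
    by rewrite !gt_eqF ?expR_gt0.
  rewrite powRM ?expR_ge0 ?invr_ge0// mulrA [expR _ `^ _]/powR gt_eqF ?expR_gt0//.
  rewrite expRK mulrA mulrC -ltr_pdivrMr//.
  apply: lt_le_trans (H2 _ y2k); rewrite mulrAC ltr_pM2r ?invr_gt0//.
  have /andP[mA _] := mP k; by have := y_ge0 k; lra.
have /andP[_ KK] := KP k.
apply: (@le_trans _ _ ((K k).+1%:R)%:E); first by rewrite lee_fin ltW.
apply: (@cover_time_gt _ _ _ _ _ _ _ _ b) => // j jK.
rewrite edistC; have [jm|mj] := ltnP j (m k); first exact: ob.
have : ~ hit f Lam (3 / 4 * rho k) (x k) (m k) (iter (j - m k) left_shift i).
  move=> Hh; apply: (k1P k k1k).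
  have jK' : (j - m k < (K k).+1)%N by rewrite ltnS (leq_trans _ jK)// leq_subr.
  by exists (Ordinal jK').
move=> Hh; rewrite leNgt; apply/negP => rj; apply: Hh.
exists (orbit_point f i x0 (j - m k)); first exact: attractor_orbit_point.
rewrite -orbit_pointE// (le_lt_trans (edist_triangle b _ _))//.
by rewrite (edistC b); move: rj; rewrite -/r; move: (rho_gt0 k); lra.
Qed.

End lower_bound.

(** * Growth exponents of cover times *)

Section limits_at_right.
Context {R : realType}.
Implicit Types (E : R -> \bar R) (t : \bar R).

Lemma at_right0P (A : set R) : (0 : R)^'+ A <->
  exists2 e : R, 0 < e & forall r, 0 < r -> r < e -> A r.
Proof.
split=> [/nbhs_ballP[e e0 H]|[e e0 H]].
  exists e => // r r0 re; apply: H => //.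
  by rewrite /ball/= sub0r normrN gtr0_norm.
apply/nbhs_ballP; exists e => // r; rewrite /ball/= sub0r normrN => re r0.
by apply: H => //; rewrite gtr0_norm in re.
Qed.

Lemma limf_esup_le E t :
  (exists2 e : R, 0 < e & forall r, 0 < r -> r < e -> (E r <= t)%E) ->
  (limf_esup E 0^'+ <= t)%E.
Proof.
move=> H; rewrite limf_esupE; apply: ereal_inf_le.
exists (ereal_sup (E @` [set r | (E r <= t)%E])).
  by exists [set r | (E r <= t)%E] => //; exact/at_right0P.
by apply: ge_ereal_sup => _ [r ? <-].
Qed.

Lemma limf_esup_ge E t :
  (forall e : R, 0 < e -> exists r, [/\ 0 < r, r < e & (t <= E r)%E]) ->
  (t <= limf_esup E 0^'+)%E.
Proof.
move=> H; rewrite limf_esupE; apply: le_ereal_inf_tmp => _ [A /at_right0P[e e0 eA] <-].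
have [r [r0 re tr]] := H e e0; apply: le_trans tr _.
by apply: ereal_sup_ubound; exists r => //; exact: eA.
Qed.

Lemma limf_einf_ge E t :
  (exists2 e : R, 0 < e & forall r, 0 < r -> r < e -> (t <= E r)%E) ->
  (t <= limf_einf E 0^'+)%E.
Proof.
move=> [e e0 H]; rewrite /limf_einf leeNr; apply: limf_esup_le; exists e => // r r0 re.
by rewrite leeN2 H.
Qed.

Lemma limf_einf_le E t :
  (forall e : R, 0 < e -> exists r, [/\ 0 < r, r < e & (E r <= t)%E]) ->
  (limf_einf E 0^'+ <= t)%E.
Proof.
move=> H; rewrite /limf_einf leeNl; apply: limf_esup_ge => e /H[r [r0 re tr]].
by exists r; rewrite leeN2.
Qed.

Lemma small_neg_ln (u0 : R) :
  exists2 e : R, 0 < e & forall r, 0 < r -> r < e -> u0 < - ln r.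
Proof.
exists (expR (- u0)); first exact: expR_gt0.
by move=> r r0 re; rewrite ltrNr -ltr_expR lnK.
Qed.

End limits_at_right.

(** * From cover times along a sequence of radii to lower and upper limits *)

Section cover_exponents.
Context {R : realType} {D N : nat}.
Variables (f : 'I_N.+1 -> 'rV[R]_D -> 'rV[R]_D) (Lam : set 'rV[R]_D).
Hypothesis Lam_attr : attractor f Lam.
Variables (i : symb N) (x : 'rV[R]_D).
Let T := cover_time f Lam i x.
Let E := cover_exponent f Lam i x.

Lemma cover_time_ge0 r : (0 <= T r)%E.
Proof. by apply: le_ereal_inf_tmp => _ [n _ <-]; rewrite lee_fin. Qed.

Lemma cover_time_anti r r' : r <= r' -> (T r' <= T r)%E.
Proof.
move=> rr; apply: le_ereal_inf => _ [n /= nr <-]; exists n => //=.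
by rewrite (lt_le_trans nr)// lee_fin.
Qed.

Lemma cover_exponent_le r v : 0 < - ln r -> (T r <= (expR v)%:E)%E ->
  (E r <= (v / - ln r)%:E)%E.
Proof.
move=> u0 Tv; rewrite /E /cover_exponent inver gt_eqF// EFinM lee_wpmul2r//.
  by rewrite lee_fin invr_ge0 ltW.
rewrite -[v]expRK -lne_EFin ?expR_gt0// lee_lne//.
  by rewrite in_itv/= leey andbT cover_time_ge0.
by rewrite in_itv/= leey andbT lee_fin expR_ge0.
Qed.

Lemma cover_exponent_ge r v : 0 < - ln r -> ((expR v)%:E <= T r)%E ->
  ((v / - ln r)%:E <= E r)%E.
Proof.
move=> u0 Tv; rewrite /E /cover_exponent inver gt_eqF// EFinM lee_wpmul2r//.
  by rewrite lee_fin invr_ge0 ltW.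
rewrite -[v]expRK -lne_EFin ?expR_gt0// lee_lne//.
  by rewrite in_itv/= leey andbT lee_fin expR_ge0.
by rewrite in_itv/= leey andbT cover_time_ge0.
Qed.

Lemma four_le_expR2 : 4 <= expR 2 :> R.
Proof.
have -> : (2 : R) = 1 + 1 by []; rewrite expRD.
by have := expR_ge1Dx (1 : R); nra.
Qed.

(** All small radii are reached by monotonicity of the cover time. For [r = expR (- u)] the index
    [k] is the integer part of [u + 2], since [4 <= expR 2]; the loss of at most [3 * t] is absorbed
    by [t' - t] for large [u]. *)
Lemma limf_esup_cover_exponent_le (t t' : R) k1 : 0 <= t -> t < t' ->
  (forall k, (k1 <= k)%N -> (T (4 * expR (- k.+1%:R)) <= (expR (t * k.+1%:R))%:E)%E) ->
  (limf_esup E 0^'+ <= t'%:E)%E.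
Proof.
move=> t0 tt' H; have tt'0 : 0 < t' - t by rewrite subr_gt0.
have [e e0 eP] := @small_neg_ln R (Num.max k1%:R (3 * t / (t' - t))).
apply: limf_esup_le; exists e => // r r0 /(eP _ r0).
rewrite gt_max => /andP[k1u]; rewrite ltr_pdivrMr//.
set u := - ln r in k1u * => ut.
have u0 : 0 < u by rewrite (le_lt_trans _ k1u).
have /andP[ku uk] : (Num.truncn (u + 2))%:R <= u + 2 < (Num.truncn (u + 2)).+1%:R.
  by apply: truncn_itv; lra.
set k := Num.truncn _ in ku uk.
have k1k : (k1 <= k)%N.
  by rewrite -ltnS -(ltr_nat R) (lt_trans k1u)// (lt_trans _ uk)//; lra.
apply: (@le_trans _ _ ((t * k.+1%:R) / u)%:E).
  apply: cover_exponent_le => //; apply: le_trans (H _ k1k); apply: cover_time_anti.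
  have -> : r = expR (- u) by rewrite /u opprK lnK.
  apply: (@le_trans _ _ (expR 2 * expR (- k.+1%:R))).
    by rewrite ler_wpM2r ?expR_ge0// four_le_expR2.
  by rewrite -expRD ler_expR; lra.
rewrite lee_fin ler_pdivrMr//.
have : t * k.+1%:R <= t * (u + 3) by rewrite ler_wpM2l// -natr1; lra.
by lra.
Qed.

Lemma limf_einf_cover_exponent_le (t t' : R) (y : nat -> R) k1 : 0 <= t -> t < t' ->
  (forall k, k%:R <= y k) ->
  (forall k, (k1 <= k)%N -> (T (4 * expR (- y k)) <= (expR (t * y k))%:E)%E) ->
  (limf_einf E 0^'+ <= t'%:E)%E.
Proof.
move=> t0 tt' ky H; have tt'0 : 0 < t' - t by rewrite subr_gt0.
apply: limf_einf_le => e e0.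
(* Here [- ln r >= y - 2]. The second bound ensures [t * y <= t' * (y - 2)] and [- ln r > 0], the
   third one [r < e]. *)
have [k kP] := exists_nat_ge (Num.max k1%:R (Num.max (3 + 2 * t' / (t' - t)) (3 - ln e))).
have yk : Num.max k1%:R (Num.max (3 + 2 * t' / (t' - t)) (3 - ln e)) <= y k.
  exact: le_trans (ky k).
have k1k : (k1 <= k)%N by move: kP; rewrite ge_max ler_nat => /andP[].
move: yk; rewrite !ge_max => /and3P[_ yt ye].
pose r := 4 * expR (- y k).
have r0 : 0 < r by rewrite mulr_gt0 ?expR_gt0.
have re2 : r <= expR (2 - y k).
  by rewrite expRD ler_wpM2r ?expR_ge0// four_le_expR2.
have t'0 : 0 <= t' by lra.
have q0 : 0 <= 2 * t' / (t' - t) by rewrite divr_ge0 ?mulr_ge0// ltW.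
have u_ge : y k - 2 <= - ln r by rewrite lerNr -ler_expR lnK// opprB.
have u0 : 0 < - ln r by lra.
exists r; split => //.
  apply: le_lt_trans re2 _; rewrite -[ltRHS]lnK// ltr_expR; lra.
apply: le_trans (cover_exponent_le u0 (H k k1k)) _.
rewrite lee_fin ler_pdivrMr//.
apply: (@le_trans _ _ (t' * (y k - 2))); last by rewrite ler_wpM2l.
have : 2 * t' / (t' - t) <= y k by lra.
by rewrite ler_pdivrMr//; lra.
Qed.

Lemma limf_einf_cover_exponent_ge (t t' delta : R) n0 k1 : 0 <= t -> 0 < delta ->
  t' * (1 + delta) < t ->
  (forall k, (k1 <= k)%N ->
    ((expR (t * (n0 + k)%:R))%:E <= T (expR (- ((1 + delta) * (n0 + k)%:R))))%E) ->
  (t'%:E <= limf_einf E 0^'+)%E.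
Proof.
move=> t0 delta0 tt' H.
have d1 : 0 < 1 + delta by lra.
(* The slack in the exponent: rounding [u / (1 + delta)] down to an integer costs at most [t], which
   is below [g * u] once [u > t / g]. *)
pose g := t / (1 + delta) - t'.
have g0 : 0 < g by rewrite /g subr_gt0 ltr_pdivlMr.
have [e e0 eP] := @small_neg_ln R
  (Num.max ((n0 + k1).+1%:R * (1 + delta)) (t / g)).
apply: limf_einf_ge; exists e => // r r0 /(eP _ r0).
rewrite gt_max => /andP[k1u]; rewrite ltr_pdivrMr//.
set u := - ln r in k1u * => ut.
have u0 : 0 < u by rewrite (le_lt_trans _ k1u)// mulr_ge0// ltW.
have /andP[nu un] : (Num.truncn (u / (1 + delta)))%:R <= u / (1 + delta)
    < (Num.truncn (u / (1 + delta))).+1%:R.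
  by apply: truncn_itv; rewrite divr_ge0 ?ltW.
set n := Num.truncn _ in nu un.
have nk : (n0 + k1 <= n)%N.
  rewrite -ltnS -(ltr_nat R) (lt_trans _ un)// ltr_pdivlMr//.
  by rewrite (lt_trans _ k1u)// ltr_pM2r// ltr_nat.
have n0n : (n0 <= n)%N by rewrite (leq_trans _ nk)// leq_addr.
apply: (@le_trans _ _ ((t * n%:R) / u)%:E); last first.
  apply: cover_exponent_ge => //.
  have := H (n - n0)%N; rewrite subnKC// => /(_ _)/le_trans; apply.
    by rewrite leq_subRL.
  apply: cover_time_anti.
  have -> : r = expR (- u) by rewrite /u opprK lnK.
  by rewrite ler_expR lerN2 mulrC -ler_pdivlMr.
rewrite lee_fin ler_pdivlMr//.
have : t * (u / (1 + delta) - 1) <= t * n%:R.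
  by rewrite ler_wpM2l// lerBlDr natr1 ltW.
have -> : t * (u / (1 + delta) - 1) = t / (1 + delta) * u - t by ring.
by move: ut; rewrite /g; lra.
Qed.

Lemma limf_esup_cover_exponent_ge (t t' delta : R) (y : nat -> R) k1 :
  0 <= t -> 0 < delta -> t' * (1 + delta) < t -> (forall k, k%:R <= y k) ->
  (forall k, (k1 <= k)%N ->
    ((expR (t * y k))%:E <= T (expR (- ((1 + delta) * y k))))%E) ->
  (t'%:E <= limf_esup E 0^'+)%E.
Proof.
move=> t0 delta0 tt' ky H.
have d1 : 0 < 1 + delta by lra.
apply: limf_esup_ge => e e0.
have [k kP] := exists_nat_ge (Num.max k1%:R (Num.max 1 (1 - ln e))).
have yk : Num.max k1%:R (Num.max 1 (1 - ln e)) <= y k by exact: le_trans (ky k).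
have k1k : (k1 <= k)%N by move: kP; rewrite ge_max ler_nat => /andP[].
move: yk; rewrite !ge_max => /and3P[_ y1 ye].
have dy : 0 < delta * y k by rewrite mulr_gt0//; lra.
have y0 : 0 < (1 + delta) * y k by lra.
exists (expR (- ((1 + delta) * y k))); split; first exact: expR_gt0.
  by rewrite -[ltRHS]lnK// ltr_expR; lra.
have u0 : 0 < - ln (expR (- ((1 + delta) * y k))) by rewrite expRK opprK.
apply: le_trans (cover_exponent_ge u0 (H k k1k)).
rewrite expRK opprK lee_fin ler_pdivlMr// mulrA ler_wpM2r ?ltW//.
lra.
Qed.

(** For small radii the starting point alone does not cover [b], so the cover time is at least 1.
    This settles negative thresholds. *)
Lemma cover_exponent_eventually_ge0 b : Lam x -> Lam b -> x != b ->
  exists2 e : R, 0 < e & forall r, 0 < r -> r < e -> (0 <= E r)%E.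
Proof.
move=> Lx Lb /edist_gt0 xb.
have [e e0 eP] := @small_neg_ln R 0.
exists (Num.min e (edist x b)); first by rewrite lt_min e0.
move=> r r0; rewrite lt_min => /andP[/(eP _ r0) u0 rb].
have : ((expR 0)%:E <= T r)%E.
  rewrite expR0; apply: (@cover_time_gt _ _ _ _ _ i x r b 0) => // j.
  by rewrite leqn0 => /eqP ->; rewrite edistC ltW.
by move/(cover_exponent_ge u0); rewrite mul0r.
Qed.

End cover_exponents.

(** * The cover time law *)

Lemma ereal_between_rat (R : realType) (x y : \bar R) : (x < y)%E ->
  exists q : rat, (x < (ratr q)%:E)%E /\ ((ratr q)%:E < y)%E.
Proof.
have real (a b : R) : a < b -> exists q : rat, a < ratr q /\ ratr q < b.
  by move=> /rat_in_itvoo[q]; rewrite in_itv/= => /andP[? ?]; exists q.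
case: x y => [x| |] [y| |] //.
- by rewrite lte_fin => /real[q [xq qy]]; exists q; rewrite !lte_fin.
- move=> _; have [|q [xq _]] := real x (x + 1); first by rewrite ltrDl.
  by exists q; rewrite lte_fin ltry.
- move=> _; have [|q [_ qy]] := real (y - 1) y; first by rewrite gtrBl.
  by exists q; rewrite lte_fin ltNyr.
- by move=> _; exists 0; rewrite ltry ltNyr.
Qed.

(** Rational thresholds suffice to identify an extended real, so that only countably many null sets
    have to be discarded. *)
Lemma ereal_eq_rat (R : realType) (x y : \bar R) :
  (forall q : rat, (y < (ratr q)%:E)%E -> (x <= (ratr q)%:E)%E) ->
  (forall q : rat, ((ratr q)%:E < y)%E -> ((ratr q)%:E <= x)%E) -> x = y.
Proof.
move=> H1 H2; apply/eqP; rewrite eq_le; apply/andP; split; rewrite leNgt; apply/negP.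
  by move=> /ereal_between_rat[q [/H1 + qx]]; rewrite leNgt qx.
by move=> /ereal_between_rat[q [xq /H2]]; rewrite leNgt xq.
Qed.

Lemma ae_forall_rat d (T : measurableType d) (R : realType)
    (mu : {measure set T -> \bar R}) (P : rat -> T -> Prop) :
  (forall q, {ae mu, forall i, P q i}) -> {ae mu, forall i, forall q, P q i}.
Proof.
move=> H.
have : {ae mu, forall i, forall n, if unpickle n is Some q then P q i else True}.
  apply: ae_foralln => n; case: (unpickle n) => [q|]; first exact: H.
  exact: aeW.
by apply: filterS => i iP q; have := iP (pickle q); rewrite pickleK.
Qed.

Section law.
Context {R : realType} {D N : nat}.
Variables (f : 'I_N.+1 -> 'rV[R]_D -> 'rV[R]_D) (Lam : set 'rV[R]_D) (a d : R).
Hypothesis a01 : 0 < a < 1.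
Hypothesis f_contr : forall c x y, edist (f c x) (f c y) <= a * edist x y.
Hypothesis Lam_attr : attractor f Lam.
Hypothesis d0 : 0 < d.
Hypothesis Lam_diam : forall x y, Lam x -> Lam y -> edist x y <= d.
Variables (alpha C : R).
Hypotheses (alpha0 : 0 < alpha) (C0 : 0 < C).
Hypothesis covering : forall (r R0 : R) x, 0 < r -> r < R0 ->
  (R0%:E <= diam Lam)%E -> Lam x ->
  ((C * (R0 / r) `^ alpha)%:E <= covering_number r (eball x R0 `&` Lam))%E.
Hypothesis Lam_nontrivial : exists x y, [/\ Lam x, Lam y & x != y].
Variables mu mur : probability (symb N) R.
Hypothesis murE : forall w, mur (cylinder w) = mu (cylinder (rev w)).
Hypothesis mu_inv : shift_invariant mu.
Hypothesis mu_decay : one_sided_exp_decay mu.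
Let nu := pushforward mur (natural_proj f).
Hypothesis nu_full : forall x (U : set 'rV[R]_D), Lam x -> open U -> U x ->
  (0 < nu U)%E.

Let le_nu_eball x y (r r' : R) : (forall z, eball x r z -> eball y r' z) ->
  (nu (eball x r `&` Lam) <= nu (eball y r' `&` Lam))%E.
Proof.
move=> H; rewrite /nu /pushforward; apply: le_measure; rewrite ?inE.
- exact: (measurable_preimage_eball a01 f_contr Lam_attr d0 Lam_diam).
- exact: (measurable_preimage_eball a01 f_contr Lam_attr d0 Lam_diam).
- by move=> i [/H]; split.
Qed.

(** By full support, the finitely many balls of radius [r / 2] around a net have positive measure,
    and every ball of radius [r] contains one of them. *)
Lemma nu_eball_bounded_below (r : R) : 0 < r ->
  exists2 eta : R, 0 < eta &
    forall x, Lam x -> (eta%:E <= nu (eball x r `&` Lam))%E.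
Proof.
move=> r0; have [_ cLam _] := Lam_attr.
have r20 : 0 < r / 2 by rewrite divr_gt0.
have [s [sL Ls]] := compact_finite_net cLam r20.
have [eta eta0 H] : exists2 eta : R, 0 < eta &
    forall y, y \in s -> (eta%:E <= nu (eball y (r / 2) `&` Lam))%E.
  elim: s sL {Ls} => [|y s IH] sL; first by exists 1.
  have [|eta eta0 H] := IH; first by move=> z zs; apply: sL; rewrite inE zs orbT.
  have : (0 < nu (eball y (r / 2) `&` Lam))%E.
    rewrite /nu /pushforward (preimage_eball_attractor a01 f_contr Lam_attr Lam_diam).
    have Ly : Lam y by apply: sL; rewrite mem_head.
    exact: (nu_full Ly (@open_eball _ _ y (r / 2)) (eball_center y r20)).
  have mB := measurable_preimage_eball a01 f_contr Lam_attr d0 Lam_diam y (r / 2).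
  have /fineK hE := fin_num_measure mur _ mB.
  rewrite -[nu _]hE lte_fin => h0.
  exists (Num.min eta (fine (nu (eball y (r / 2) `&` Lam)))).
    by rewrite lt_min eta0.
  move=> z; rewrite inE => /orP[/eqP->|/H].
    by rewrite -[nu (eball y _ `&` _)]hE lee_fin ge_min lexx orbT.
  by apply: le_trans; rewrite lee_fin ge_min lexx.
exists eta => // x /Ls[y ys yx]; apply: (le_trans (H y ys)).
apply: le_nu_eball => z; rewrite /eball/= => yz.
by have := edist_triangle y x z; rewrite (edistC x y); lra.
Qed.

Lemma ae_limf_einf_le (q : R) : (lower_minkowski nu Lam < q%:E)%E ->
  {ae mu, forall i, forall x, Lam x ->
    (limf_einf (cover_exponent f Lam i x) 0^'+ <= q%:E)%E}.
Proof.
move=> /ereal_inf_lt[_ [s [s0 [c c0 [u [u0 u_cvg Hu]]]] <-]]; rewrite lte_fin => sq.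
(* A selection of the admissible radii that decays at least exponentially, as Borel-Cantelli
   requires. *)
have /choice[g gP] k : exists n, u n <= expR (- k%:R).
  move: u_cvg => /cvgr0Pnorm_lt/(_ _ (expR_gt0 (- k%:R)))[n _ nP]; exists n.
  by rewrite (le_trans (ler_norm _))// ltW// nP//=.
pose y k := - ln (u (g k)).
have ey k : expR (- y k) = u (g k) by rewrite opprK lnK// posrE.
have ky k : k%:R <= y k by rewrite /y lerNr -ler_expR lnK ?posrE.
have st : s < (s + q) / 2 by lra.
have tq : (s + q) / 2 < q by lra.
have t0 : 0 <= (s + q) / 2 by lra.
apply: filterS (ae_cover_time_le a01 f_contr Lam_attr d0 Lam_diam murE mu_inv mu_decay
  s0 st c0 ky _).
  move=> i [k1 H] x Lx; apply: (limf_einf_cover_exponent_le t0 tq ky (k1 := k1)).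
  by move=> k k1k; exact: H.
move=> k x Lx; rewrite ey; apply: le_trans (Hu x (g k) Lx).
by rewrite lee_fin -ey -expRM mulNr [y k * s]mulrC.
Qed.

Lemma ae_limf_esup_le (q : R) : (upper_minkowski nu Lam < q%:E)%E ->
  {ae mu, forall i, forall x, Lam x ->
    (limf_esup (cover_exponent f Lam i x) 0^'+ <= q%:E)%E}.
Proof.
move=> /ereal_inf_lt[_ [s [s0 [c c0 Hc]] <-]]; rewrite lte_fin => sq.
(* Starting from 1 keeps all radii strictly below 1, as the definition of the upper dimension
   demands. *)
pose y k : R := k.+1%:R.
have ky k : k%:R <= y k by rewrite ler_nat.
have st : s < (s + q) / 2 by lra.
have tq : (s + q) / 2 < q by lra.
have t0 : 0 <= (s + q) / 2 by lra.
apply: filterS (ae_cover_time_le a01 f_contr Lam_attr d0 Lam_diam murE mu_inv mu_decay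
  s0 st c0 ky _).
  move=> i [k1 H] x Lx; apply: (limf_esup_cover_exponent_le t0 tq (k1 := k1)).
  by move=> k k1k; exact: H.
move=> k x Lx; apply: le_trans (Hc x _ Lx _ _); rewrite ?expR_gt0//.
  by rewrite lee_fin -expRM mulNr [y k * s]mulrC.
by rewrite expR_lt1 oppr_lt0 ltr0n.
Qed.

(** The gap between [q] and [s] is shared between the union bound over times, which needs [t < s],
    and the shrinking of the radius, which needs [delta]. *)
Let exponent_gap (q s : R) : 0 <= q -> q < s ->
  exists t delta : R, [/\ 0 <= t, t < s, 0 < delta & q * (1 + delta) < t].
Proof.
move=> q0 qs; exists ((q + s) / 2), ((s - q) / (4 * (q + 1))).
have d1 : 0 < (s - q) / (4 * (q + 1)) by rewrite divr_gt0 ?mulr_gt0//; lra.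
split => //; [lra|lra|].
have : (s - q) / (4 * (q + 1)) * (4 * (q + 1)) = s - q.
  by rewrite divfK// gt_eqF// mulr_gt0//; lra.
by move: d1; set z := _ / _; nra.
Qed.

Let real_between (q : R) (L : \bar R) : (q%:E < L)%E ->
  exists2 s : R, q < s & (s%:E < L)%E.
Proof.
by move=> /ereal_between_rat[r [qr rL]]; exists (ratr r).
Qed.

Lemma ae_limf_einf_ge (q : R) : (q%:E < lower_minkowski nu Lam)%E ->
  {ae mu, forall i, forall x, Lam x ->
    (q%:E <= limf_einf (cover_exponent f Lam i x) 0^'+)%E}.
Proof.
move=> qL; have [q0|q0] := ltP q 0.
  apply: aeW => i x Lx; have [b [Lb xb]] : exists b, Lam b /\ x != b.
    have [b1 [b2 [Lb1 Lb2 b12]]] := Lam_nontrivial.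
    by have [xb|xb] := eqVneq x b1; [exists b2; rewrite xb|exists b1].
  apply: limf_einf_ge.
  have [e e0 H] := cover_exponent_eventually_ge0 f i Lx Lb xb.
  exists e => // r r0 re; apply: le_trans (H r r0 re).
  by rewrite lee_fin ltW.
have [s qs sL] := real_between qL.
have s0 : 0 <= s by lra.
(* If all balls of radius [expR (- n)] were large for infinitely many [n], these radii would make
   [s] admissible for the lower dimension. So every large [n] has a small ball. *)
have [n0 Hn0] : exists n0 : nat, forall n, (n0 <= n)%N -> exists2 x, Lam x &
    (nu (eball x (expR (- n%:R)) `&` Lam) < (expR (- (s * n%:R)))%:E)%E.
  apply: contrapT => Hn.
  have /choice[g gP] k : exists n, (k <= n)%N /\ forall x, Lam x ->
      ((expR (- (s * n%:R)))%:E <= nu (eball x (expR (- n%:R)) `&` Lam))%E.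
    apply: contrapT => Hk; apply: Hn; exists k => n kn.
    apply: contrapT => Hx; apply: Hk; exists n; split => // x Lx.
    by rewrite leNgt; apply/negP => Hlt; apply: Hx; exists x.
  move: sL; apply/negP; rewrite -leNgt; apply: ereal_inf_lbound; exists s => //.
  split => //; exists 1 => //; exists (fun k => expR (- (g k)%:R)); split.
  - by move=> k; exact: expR_gt0.
  - apply/cvgr0Pnorm_lt => e e0.
    have [k kP] := exists_nat_ge (1 - ln e); exists k => // n /= kn.
    rewrite gtr0_norm ?expR_gt0// -[ltRHS]lnK// ltr_expR.
    have [ng _] := gP n.
    have : k%:R <= (g n)%:R :> R by rewrite ler_nat (leq_trans kn).
    by lra.
  - move=> x k Lx; rewrite mul1r; have [_ /(_ x Lx)] := gP k.
    by rewrite -expRM mulNr [_%:R * s]mulrC.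
have /choice[x xP] k : exists x, Lam x /\
    (nu (eball x (expR (- (n0 + k)%:R)) `&` Lam) <= (expR (- (s * (n0 + k)%:R)))%:E)%E.
  by have [x Lx /ltW] := Hn0 (n0 + k)%N (leq_addr _ _); exists x.
have [t [delta [t0 ts delta0 qt]]] := exponent_gap q0 qs.
have ky k : k%:R <= (n0 + k)%:R :> R by rewrite ler_nat leq_addl.
apply: filterS (ae_cover_time_ge a01 f_contr Lam_attr d0 Lam_diam alpha0 C0 covering
  Lam_nontrivial murE mu_inv t0 ts delta0 ky
  (fun k => proj1 (xP k)) (fun k => proj2 (xP k))).
move=> i [k1 H] b Lb.
by apply: (limf_einf_cover_exponent_ge t0 delta0 qt (k1 := k1)) => k k1k; exact: H.
Qed.

(** Inadmissibility of [s] for the upper dimension provides small balls at arbitrarily small radii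
    only, which is enough for an upper limit. *)
Lemma ae_limf_esup_ge (q : R) : (q%:E < upper_minkowski nu Lam)%E ->
  {ae mu, forall i, forall x, Lam x ->
    (q%:E <= limf_esup (cover_exponent f Lam i x) 0^'+)%E}.
Proof.
move=> qL; have [q0|q0] := ltP q 0.
  apply: aeW => i x Lx; have [b [Lb xb]] : exists b, Lam b /\ x != b.
    have [b1 [b2 [Lb1 Lb2 b12]]] := Lam_nontrivial.
    by have [xb|xb] := eqVneq x b1; [exists b2; rewrite xb|exists b1].
  apply: limf_esup_ge => e e0.
  have [e' e'0 H] := cover_exponent_eventually_ge0 f i Lx Lb xb.
  have m0 : 0 < Num.min e e' by rewrite lt_min e0.
  have m2 : Num.min e e' / 2 < Num.min e e' by lra.
  exists (Num.min e e' / 2); split; first by rewrite divr_gt0.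
    by rewrite (lt_le_trans m2)// ge_min lexx.
  apply: (@le_trans _ _ 0%E); first by rewrite lee_fin ltW.
  by apply: H; [rewrite divr_gt0|rewrite (lt_le_trans m2)// ge_min lexx orbT].
have [s qs sL] := real_between qL.
have s0 : 0 <= s by lra.
have /choice[g gP] k : exists p : R * 'rV[R]_D, [/\ k%:R <= p.1, Lam p.2 &
    (nu (eball p.2 (expR (- p.1)) `&` Lam) <= (expR (- (s * p.1)))%:E)%E].
  (* Testing [s] with the constant [eta] forces radii below [expR (- k)]. *)
  have [eta eta0 etaP] := nu_eball_bounded_below (expR_gt0 (- k%:R : R)).
  apply: contrapT => Hk; move: sL; apply/negP; rewrite -leNgt.
  apply: ereal_inf_lbound; exists s => //; split => //.
  exists (Num.min 1 eta); first by rewrite lt_min eta0 ltr01.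
  move=> x r Lx r0 r1; have [rk|rk] := leP r (expR (- k%:R)).
    rewrite leNgt; apply/negP => Hr; apply: Hk; exists (- ln r, x) => /=.
    split => //; first by rewrite lerNr -ler_expR lnK.
    rewrite opprK lnK// (le_trans (ltW Hr))// lee_fin.
    have -> : expR (- (s * - ln r)) = r `^ s.
      by rewrite -[in RHS](lnK r0) -expRM; congr expR; ring.
    by rewrite ler_piMl ?powR_ge0// ge_min lexx.
  apply: (@le_trans _ _ eta%:E); last first.
    apply: le_trans (etaP x Lx) _; apply: le_nu_eball => z; rewrite /eball/=.
    by move/lt_trans; exact.
  rewrite lee_fin -[leRHS]mulr1; apply: ler_pM; rewrite ?powR_ge0//.
  - by rewrite le_min ltW// ltW.
  - by rewrite ge_min lexx orbT.
  - apply: (@le_trans _ _ (1 `^ s)); last by rewrite powR1.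
    by rewrite ge0_ler_powR ?nnegrE ?(ltW r0)// ltW.
have [t [delta [t0 ts delta0 qt]]] := exponent_gap q0 qs.
have ky k : k%:R <= (g k).1 by have [] := gP k.
have Lx k : Lam (g k).2 by have [] := gP k.
have nux k : (nu (eball (g k).2 (expR (- (g k).1)) `&` Lam) <=
    (expR (- (s * (g k).1)))%:E)%E by have [] := gP k.
apply: filterS (ae_cover_time_ge a01 f_contr Lam_attr d0 Lam_diam alpha0 C0 covering
  Lam_nontrivial murE mu_inv t0 ts delta0 ky Lx nux).
move=> i [k1 H] b Lb.
by apply: (limf_esup_cover_exponent_ge t0 delta0 qt ky (k1 := k1)) => k k1k; exact: H.
Qed.

Lemma ae_cover_time_law : cover_time_law f Lam mu nu.
Proof.
(* Moves the condition on the threshold inside, so that all rationals can be quantified over at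
   once. *)
have ae_imp (P : Prop) (Q : symb N -> Prop) : (P -> {ae mu, forall i, Q i}) ->
    {ae mu, forall i, P -> Q i}.
  move=> PQ; have [p|np] := pselect P; last exact: aeW.
  by apply: filterS (PQ p) => i.
have H1 := ae_forall_rat (fun q : rat => ae_imp _ _ (@ae_limf_einf_le (ratr q))).
have H2 := ae_forall_rat (fun q : rat => ae_imp _ _ (@ae_limf_einf_ge (ratr q))).
have H3 := ae_forall_rat (fun q : rat => ae_imp _ _ (@ae_limf_esup_le (ratr q))).
have H4 := ae_forall_rat (fun q : rat => ae_imp _ _ (@ae_limf_esup_ge (ratr q))).
apply: filterS2 (filterI H1 H2) (filterI H3 H4) => i [i1 i2] [i3 i4] x Lx.
by split; apply: ereal_eq_rat => q ?; [exact: i1|exact: i2|exact: i3|exact: i4].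
Qed.

End law.

(** * Bernoulli measures *)

HB.instance Definition _ (N : nat) :=
  isMeasurableFun.Build _ _ (symb N) (symb N) (@left_shift N) measurable_left_shift.

Section cylinder_generation.
Context {N : nat}.

(** The empty set is included to make the family a pi-system, since two cylinders are nested or
    disjoint. *)
Definition cylinders : set (set (symb N)) :=
  [set A | A = set0 \/ exists w, A = cylinder w].

Lemma cylinder_subset (w v : seq 'I_N.+1) i : (size w <= size v)%N ->
  cylinder w i -> cylinder v i -> cylinder v `<=` cylinder w.
Proof.
move=> wv wi vi j vj; rewrite /cylinder/= -{2}wi; apply: word_prefix_le wv _.
by rewrite vj vi.
Qed.

Lemma setI_closed_cylinders : setI_closed cylinders.
Proof.
move=> A B [->|[w ->]]; first by rewrite set0I; left.
move=> [->|[v ->]]; first by rewrite setI0; left.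
have [[i [wi vi]]|wv] := pselect (cylinder w `&` cylinder v !=set0).
  right; case/orP: (leq_total (size w) (size v)) => wv.
    by exists v; apply/setIidr; exact: cylinder_subset vi.
  by exists w; apply/setIidl; exact: cylinder_subset wi.
by left; apply/seteqP; split=> // i iwv; case: wv; exists i.
Qed.

Lemma measurable_cylinders : @measurable _ (symb N) = <<s cylinders >>.
Proof.
apply/seteqP; split.
  apply: smallest_sub; first exact: smallest_sigma_algebra.
  move=> U oU.
  have -> : U = \bigcup_n \bigcup_(w in
      [set w : n.-tuple 'I_N.+1 | cylinder w `<=` U]) cylinder w.
    apply/seteqP; split=> i; last by move=> [n _ [w wU]]; exact: wU.
    move=> /(cylinder_open_base oU)[n nU]; exists n => //.
    by exists (Tuple (introT eqP (size_word_prefix i n))) => //; exact: cylinder_prefix.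
  apply: (@bigcupT_measurable _ (g_sigma_algebraType cylinders)) => n.
  apply: fin_bigcup_measurable; first exact: finite_finset.
  by move=> w _; apply: sub_sigma_algebra; right; exists w.
apply: smallest_sub; first exact: sigma_algebra_measurable.
by move=> _ [->|[w ->]]; [exact: measurable0|exact: measurable_cylinder].
Qed.

End cylinder_generation.

Section bernoulli.
Context {R : realType} {N : nat}.
Variables (p : 'I_N.+1 -> R) (mu : probability (symb N) R).
Hypothesis p_gt0 : forall c, 0 < p c.
Hypothesis muE : bernoulli_measure p mu.

Lemma bernoulli_cylinder_gt0 w : (0 < mu (cylinder w))%E.
Proof. by rewrite muE lte_fin prodr_gt0. Qed.

Lemma bernoulli_rev w : mu (cylinder w) = mu (cylinder (rev w)).
Proof. by rewrite !muE (perm_big (rev w))// perm_sym perm_rev. Qed.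

Lemma bernoulli_cat w v :
  mu (cylinder (w ++ v)) = (mu (cylinder w) * mu (cylinder v))%E.
Proof. by rewrite !muE big_cat EFinM. Qed.

(** Summing over the [g] letters in between, the middle factors add up to the total mass 1. *)
Lemma bernoulli_indep w g v :
  mu (cylinder w `&` iter (size w + g) left_shift @^-1` cylinder v) =
  (mu (cylinder w) * mu (cylinder v))%E.
Proof.
have mv : measurable (iter (size w + g) left_shift @^-1` @cylinder N v).
  by apply: measurable_iter_left_shift; exact: measurable_cylinder.
rewrite (@measure_sum_cylinder_shift _ _ mu (size w) g); last first.
  by apply: measurableI => //; exact: measurable_cylinder.
transitivity (\sum_(u : g.-tuple 'I_N.+1)
    (mu (cylinder w) * mu (cylinder v)) * mu (cylinder u))%E.
  apply: eq_bigr => u _; rewrite [RHS]muleAC -!bernoulli_cat -catA.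
  rewrite cylinder_cat cylinder_cat size_tuple -setIA; congr (mu (_ `&` _)).
  rewrite preimage_setI setIC; congr (_ `&` _).
  by apply/seteqP; split=> i /=; rewrite addnC iterD.
rewrite -ge0_sume_distrr; last by move=> u _; exact: measure_ge0.
have /esym := @measure_sum_cylinder _ _ mu g setT measurableT.
under eq_bigr do rewrite setTI; move=> ->.
by rewrite probability_setT mule1.
Qed.

Lemma bernoulli_shift_invariant : shift_invariant mu.
Proof.
move=> A mA.
apply: (@measure_unique _ R (symb N) cylinders (fun=> cylinder [::])
  measurable_cylinders setI_closed_cylinders _ _
  (distribution mu (@left_shift N)) mu) => //.
- by move=> _; right; exists [::].
- by rewrite bigcup_const//; apply/seteqP; split.
- move=> _ [->|[w ->]]; first by rewrite !measure0.
  (* The preimage of a cylinder under the shift is the case of an empty first word and a gap of one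
     letter; uniqueness of measures on a pi-system does the rest. *)
  have := bernoulli_indep [::] 1 w; rewrite [cylinder [::]](_ : _ = setT).
    by rewrite setTI probability_setT mul1e.
  by apply/seteqP; split.
- move=> _; rewrite (le_lt_trans (probability_le1 _ _)) ?ltry//.
  exact: measurable_cylinder.
Qed.

Lemma bernoulli_exp_decay : one_sided_exp_decay mu.
Proof.
exists 1, 1; split => // w v n wn.
rewrite -{1}(subnKC wn) bernoulli_indep -muleA.
rewrite !muE -!EFinM lee_fin ler_peMl ?mulr_ge0//.
- by apply: prodr_ge0 => c _; exact: ltW.
- by apply: prodr_ge0 => c _; exact: ltW.
- by rewrite lerDl mul1r powR_ge0.
Qed.

End bernoulli.

(** Every point of [Lam] is the image of a point of [Lam] under a long word [w], and the cylinder of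
    [w] projects to within [a ^+ m * d] of it. *)
Lemma pushforward_cylinder_gt0 (R : realType) (D N : nat)
    (f : 'I_N.+1 -> 'rV[R]_D -> 'rV[R]_D) (Lam : set 'rV[R]_D) (a d : R)
    (mu : probability (symb N) R) :
  0 < a < 1 -> (forall c x y, edist (f c x) (f c y) <= a * edist x y) ->
  attractor f Lam -> 0 < d -> (forall x y, Lam x -> Lam y -> edist x y <= d) ->
  (forall w, 0 < mu (cylinder w))%E ->
  forall x (U : set 'rV[R]_D), Lam x -> open U -> U x ->
    (0 < pushforward mu (natural_proj f) U)%E.
Proof.
move=> a01 f_contr Lam_attr d0 Lam_diam mu_gt0 x U Lx oU Ux.
have /nbhs_eball[e e0 eU] : nbhs x U by apply: open_nbhs_nbhs.
have /cvgr0Pnorm_lt/(_ _ e0)[m _ /(_ m (leqnn m)) lt_e] := cvg_expr_mulr a01 d.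
have [w [y [Ly xE]]] := attractor_word_ex Lam_attr m Lx.
apply: (lt_le_trans (mu_gt0 w)); rewrite /pushforward; apply: le_measure; rewrite ?inE.
- exact: measurable_cylinder.
- exact: (measurable_preimage_natural_proj a01 f_contr Lam_attr Lam_diam d0 oU).
move=> i; rewrite /cylinder/= size_tuple => iw; apply: eU; rewrite /eball/= xE.
have [_ /(_ m y Ly)] := natural_proj_attractor a01 f_contr Lam_attr Lam_diam i.
by rewrite iw => /le_lt_trans; apply; rewrite (le_lt_trans (ler_norm _)).
Qed.

Theorem theorem2p1 (R : realType) (D N : nat)
    (f : 'I_N.+1 -> 'rV[R]_D -> 'rV[R]_D) (Lam : set 'rV[R]_D)
    (f_contr : strictly_contracting f)
    (Lam_attr : attractor f Lam)
    (Lam_dim : (0 < lower_dim Lam)%E) :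
  (forall mu mur : probability (symb N) R,
     shift_invariant mu ->
     one_sided_exp_decay mu ->
     reversed_measure mu mur ->
     fully_supported (pushforward mur (natural_proj f)) Lam ->
     cover_time_law f Lam mu (pushforward mur (natural_proj f)))
  /\
  (forall (p : 'I_N.+1 -> R) (mu_p : probability (symb N) R),
     (forall c, 0 < p c) ->
     \sum_c p c = 1 ->
     bernoulli_measure p mu_p ->
     cover_time_law f Lam mu_p (pushforward mu_p (natural_proj f))).
Proof.
have [a a01 fa] := f_contr.
have [Lam_ne cLam _] := Lam_attr.
have [d d0 Lam_diam] := compact_edist_bounded cLam Lam_ne.
move: Lam_dim; rewrite /lower_dim; case: asboolP; first by rewrite ltxx.
move=> Lam_single /ereal_sup_gt[_ [alpha [C C0 covering] <-]].
rewrite lte_fin => alpha0.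
(* A single point has lower dimension 0 by convention, so positivity provides two points. *)
have Lam_nontrivial : exists x y, [/\ Lam x, Lam y & x != y].
  apply: contrapT => H; have [x Lx] := Lam_ne; apply: Lam_single; exists x.
  apply/seteqP; split=> [y Ly|y ->//]; apply/eqP; apply: contrapT => yx.
  by apply: H; exists y, x; split => //; exact/negP.
split=> [mu mur mu_inv mu_decay [_ murE] nu_full|p mu p_gt0 _ muE].
- apply: (ae_cover_time_law a01 fa Lam_attr d0 Lam_diam alpha0 C0 covering
    Lam_nontrivial murE mu_inv mu_decay) => x U Lx oU Ux.
  suff Hx : measure_support (pushforward mur (natural_proj f)) x by exact: Hx.
  by rewrite nu_full.
(* A Bernoulli measure gives a word and its reversal the same mass, so it serves as its own reversed
   measure. *)
- apply: (ae_cover_time_law a01 fa Lam_attr d0 Lam_diam alpha0 C0 covering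
    Lam_nontrivial (bernoulli_rev muE) (bernoulli_shift_invariant muE)
    (bernoulli_exp_decay p_gt0 muE)).
  apply: (pushforward_cylinder_gt0 a01 fa Lam_attr d0 Lam_diam).
  exact: bernoulli_cylinder_gt0.
Qed.
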